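(* There exist a Riemannian metric $g$ on the $2$-dimensional torus $\mathbb{T}^2$ and a sequence $(\phi_i)_{i\ge 1}$ of eigenfunctions of the Laplace--Beltrami operator $\Delta_g$, with $\Delta_g\phi_i+\lambda_i\phi_i=0$ and $\lambda_i\to\infty$ as $i\to\infty$, such that each $\phi_i$ has infinitely many isolated critical points on $\mathbb{T}^2$ and, moreover, for each $i$ there is $L_i\in\mathbb{R}$ such that the level set $\{p\in\mathbb{T}^2 : \phi_i(p)=L_i\}$ has infinitely many connected components. In particular, there are a Riemannian metric on $\mathbb{T}^2$ and a linear combination of two eigenfunctions of its Laplace--Beltrami operator which has infinitely many nodal domains.
   Context: Riemannian metrics are smooth ($C^\infty$). Eigenfunctions are smooth, real-valued and not identically zero. The sign convention is that $\phi$ is an eigenfunction with eigenvalue $\lambda\ge 0$ if $\Delta_g\phi+\lambda\phi=0$; constant functions are eigenfunctions with eigenvalue $0$. A critical point of $\phi$ is a point where $d\phi=0$; it is isolated if it has a neighbourhood containing no other critical point of $\phi$. The nodal domains of a continuous function $f$ on $\mathbb{T}^2$ are the connected components of $\{p\in\mathbb{T}^2: f(p)\neq 0\}$. *)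

(* Defs.v *)
From HB Require Import structures.
From mathcomp Require Import all_boot all_order all_algebra.
From mathcomp Require Import all_classical all_reals all_analysis.
Set Implicit Arguments.
Unset Strict Implicit.
Unset Printing Implicit Defensive.
Import Order.TTheory GRing.Theory Num.Theory.
Import numFieldNormedType.Exports.
Local Open Scope classical_set_scope.
Local Open Scope quotient_scope.
Local Open Scope ring_scope.

(* The torus T^2 is the topological quotient of the plane 'rV[R]_2 by the      *)
(* lattice of integer vectors. A function on T^2 is handled, for everything    *)
(* involving derivatives, through its lift to the plane, i.e. its composition  *)
(* with the covering map, which is a local diffeomorphism by definition of     *)
(* the smooth structure of T^2.                                                *)

Section Torus.
Context {R : realType}.

Definition lattice_eq (x y : 'rV[R]_2) : bool := x - y \is a mxOver Num.int.

Lemma lattice_eq_equiv : equiv_class_of lattice_eq.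
Proof.
split=> [x|x y|y x z].
- by apply/mxOverP => i j; rewrite subrr mxE rpred0.
- suff sym u v : lattice_eq u v -> lattice_eq v u by apply/idP/idP; exact: sym.
  move=> /mxOverP uv; apply/mxOverP => i j.
  by rewrite -opprB mxE rpredN.
- move=> /mxOverP xy /mxOverP yz; apply/mxOverP => i j.
  by rewrite -(subrKA y) mxE rpredD.
Qed.

Canonical lattice_equiv := EquivRelPack lattice_eq_equiv.

End Torus.

Definition torus (R : realType) : topologicalType :=
  quotient_topology {eq_quot (@lattice_equiv R)}.

Section Geometry.
Context {R : realType}.
Local Notation plane := 'rV[R]_2.
Local Notation T2 := (torus R).

Definition torus_pi (x : plane) : T2 :=
  \pi_(quotient_topology {eq_quot (@lattice_equiv R)}) x.

Definition torus_repr (p : T2) : plane :=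
  repr (p : quotient_topology {eq_quot (@lattice_equiv R)}).

Definition lift_fun (V : Type) (f : T2 -> V) : plane -> V := f \o torus_pi.

Definition partial (i : 'I_2) (f : plane -> R) : plane -> R :=
  'D_(delta_mx 0 i) f.

Fixpoint Ck (k : nat) (f : plane -> R) : Prop :=
  if k is k'.+1 then
    continuous f /\
    forall i : 'I_2,
      (forall x, derivable f x (delta_mx 0 i)) /\ Ck k' (partial i f)
  else continuous f.

Definition smooth (f : T2 -> R) : Prop := forall k, Ck k (lift_fun f).

(* The coordinate fields of the plane descend to a global frame of the tangent *)
(* bundle of T^2, so a metric is a field of Gram matrices in this frame.       *)
Record riemannian_metric := RiemannianMetric {
  gram :> T2 -> 'M[R]_2;
  gram_smooth : forall i j, smooth (fun p => gram p i j);
  gram_sym : forall p, (gram p)^T = gram p;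
  gram_pos : forall p (v : 'rV[R]_2),
    v != 0 -> 0 < (v *m gram p *m v^T) 0 0 }.

(* |g|^(-1/2) \sum_(i, j) d_i (|g|^(1/2) g^(ij) d_j f).                        *)
(* The expression is lattice-periodic, so that it does not matter at which     *)
(* representative of p it is evaluated.                                        *)
Definition laplace_beltrami (g : riemannian_metric) (f : T2 -> R) (p : T2) : R :=
  let G := lift_fun g in
  let F := lift_fun f in
  let vol x := Num.sqrt (\det (G x)) in
  let x := torus_repr p in
  (vol x)^-1 *
  \sum_(i < 2) \sum_(j < 2)
    partial i (fun y => vol y * invmx (G y) i j * partial j F y) x.

Definition eigenfunction (g : riemannian_metric) (lambda : R) (phi : T2 -> R) :
    Prop :=
  [/\ 0 <= lambda, smooth phi, exists p, phi p != 0 &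
      forall p, laplace_beltrami g phi p + lambda * phi p = 0].

Definition critical_point (phi : T2 -> R) (p : T2) : Prop :=
  forall v : plane, 'd (lift_fun phi) (torus_repr p) v = 0.

Definition isolated_critical_point (phi : T2 -> R) (p : T2) : Prop :=
  critical_point phi p /\
  exists2 U : set T2, nbhs p U & forall q, U q -> critical_point phi q -> q = p.

Definition components (A : set T2) : set (set T2) :=
  connected_component A @` A.

Definition nodal_domains (f : T2 -> R) : set (set T2) :=
  components [set p | f p != 0].

End Geometry.
Arguments riemannian_metric : clear implicits.

(* Main.v *)
Require Import Defs.
From mathcomp Require Import all_boot all_order all_algebra.
From mathcomp Require Import all_classical all_reals all_analysis.
From mathcomp Require Import ring lra.
Import Order.TTheory GRing.Theory Num.Theory.
Import numFieldNormedType.Exports.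
Local Open Scope classical_set_scope.
Local Open Scope ring_scope.
Set Implicit Arguments.
Unset Strict Implicit.
Unset Printing Implicit Defensive.

(** The metric is conformal to the flat one, g = Q(x) (dx^2 + dy^2), with
Q = 1 + eps G'' a small flat perturbation of 1: G(x) = exp(-1/s) sin(1/s),
s = sin(6 pi x), extended by 0 where s <= 0, is smooth, of period 1/3, and
oscillates infinitely often to the right of x = 0. By separation of variables
    phi(x, y) = u(x) cos(2 pi y) - v(x) sin(2 pi y)
is an eigenfunction of eigenvalue l as soon as u and v are 1-periodic solutions
of F'' = (4 pi^2 - l Q) F.

A given 1-periodic solution would impose conditions on l that compete with the
local behaviour wanted at x = 0. The period 1/3 of Q removes this conflict: if
the monodromy matrix M of the equation over one third of the circle has trace
-1, then M^2 + M + 1 = 0, hence M^3 = 1 and all solutions are 1-periodic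
(sol_period3). By a WKB estimate the trace is close to 2 (-1)^m at the
frequencies sqrt l = m pi / theta, where theta is the integral of sqrt Q over
one third of the circle, so the intermediate value theorem gives arbitrarily
large l with trace -1 (trace_minus_one).

For such l the data of (u, v) at x = 0 are free, and they are taken to be those
of the plane wave u + i v = exp(i w x), w^2 = l - 4 pi^2. With constant Q the
squared amplitude R = u^2 + v^2 would be constant; here a bootstrap in the
linear system satisfied by R - 1, R'/2 and an auxiliary quantity shows that
R = 1 - 2 l eps G + (smaller terms) as x decreases to 0 (local_asymptotics).
Hence R - 1 changes sign infinitely often, and the zeros of R' close to 0 are
simple (bumps, nondegenerate).

On the vertical circle over x the function phi equals sqrt R cos(2 pi y + c).
Every maximum point x of R with R > 1 therefore carries an isolated critical
point of phi (wave_isolated). The circles over points with R < 1 do not meet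
the set phi >= 1, and they separate these maxima from each other; so both the
level set phi = 1 and the part phi > 1 of the complement of that level set have
infinitely many components (wave_geometry). The second fact is the statement
about linear combinations, since the constant 1 is an eigenfunction. *)

(** * Derivatives, mean value estimates and antiderivatives on the line *)

Section Calculus.
Context {R : realType}.
Implicit Types (f g h : R -> R) (a b c x y : R).

Definition der f f' := forall x, is_derive x (1 : R) f (f' x).

Lemma der_ext f f' g g' : der f f' -> f =1 g -> f' =1 g' -> der g g'.
Proof. by move=> H /funext <- /funext <-. Qed.

Lemma der_eq f f' g' : der f f' -> f' =1 g' -> der f g'.
Proof. by move=> H /funext <-. Qed.

Lemma der_cst c : der (fun=> c) (fun=> 0).
Proof. by move=> x; exact: is_derive_cst. Qed.

Lemma der_id : der id (fun=> 1).
Proof. by move=> x; exact: is_derive_id. Qed.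

Lemma derD f f' g g' : der f f' -> der g g' ->
  der (fun x => f x + g x) (fun x => f' x + g' x).
Proof. by move=> H1 H2 x; have := H1 x; have := H2 x; move=> ? ?; exact: is_deriveD. Qed.

Lemma derN f f' : der f f' -> der (fun x => - f x) (fun x => - f' x).
Proof. by move=> H1 x; have := H1 x => ?; exact: is_deriveN. Qed.

Lemma derB f f' g g' : der f f' -> der g g' ->
  der (fun x => f x - g x) (fun x => f' x - g' x).
Proof. by move=> H1 H2; apply: derD => //; exact: derN. Qed.

Lemma derM f f' g g' : der f f' -> der g g' ->
  der (fun x => f x * g x) (fun x => f' x * g x + f x * g' x).
Proof.
move=> H1 H2 x; have := H1 x; have := H2 x => ? ?.
by apply: is_derive_eq; rewrite /GRing.scale/= addrC [g x * _]mulrC.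
Qed.

Lemma derZ c f f' : der f f' -> der (fun x => c * f x) (fun x => c * f' x).
Proof. by move=> H; apply: (der_eq (derM (der_cst c) H)) => x; rewrite mul0r add0r. Qed.

Lemma der_comp f f' g g' : der f f' -> der g g' ->
  der (fun x => f (g x)) (fun x => f' (g x) * g' x).
Proof. by move=> H1 H2 x; have := H1 (g x); have := H2 x => ? ?; exact: is_derive1_comp. Qed.

Lemma derV f f' : (forall x, f x != 0) -> der f f' ->
  der (fun x => (f x)^-1) (fun x => - f' x * ((f x)^-1 * (f x)^-1)).
Proof.
move=> f0 H x; have := H x => ?; have := is_deriveV (f0 x) => /(_ 1 (f' x) _) K.
by apply: is_derive_eq; rewrite /GRing.scale/= expr2 invfM mulrC; ring.
Qed.

Lemma der_exp : der (@expR R) (@expR R).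
Proof. by move=> x; exact: is_derive_expR. Qed.
Lemma der_sin : der (@sin R) (@cos R).
Proof. by move=> x; exact: is_derive_sin. Qed.
Lemma der_cos : der (@cos R) (fun x => - sin x).
Proof. by move=> x; exact: is_derive_cos. Qed.

Lemma der_cont f f' : der f f' -> continuous f.
Proof.
by move=> H x; apply/differentiable_continuous/derivable1_diffP; case: (H x).
Qed.

Lemma cont_within f (A : set R) : continuous f -> {within A, continuous f}.
Proof. by move=> H; apply/continuous_subspaceT => x; exact: H. Qed.

Lemma der_mono f f' a b : der f f' -> a <= b ->
  (forall x, a < x -> x < b -> 0 <= f' x) -> f a <= f b.
Proof.
move=> H ab P.
have [||c] := @MVT_segment R f (fun x => if (a < x) && (x < b) then f' x else 0) a b ab.
- move=> x; rewrite in_itv/= => -> ; exact: H.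
- by apply: cont_within; apply: der_cont H.
- move=> _ e; rewrite -subr_ge0 e mulr_ge0 ?subr_ge0//.
  by case: ifP => // /andP[? ?]; exact: P.
Qed.

Lemma der_le f f' g g' a b : der f f' -> der g g' -> a <= b ->
  (forall x, a < x -> x < b -> f' x <= g' x) -> f b - f a <= g b - g a.
Proof.
move=> Hf Hg ab P.
have K : g a - f a <= g b - f b.
  apply: (der_mono (derB Hg Hf) ab) => x ax xb; rewrite subr_ge0; exact: P.
lra.
Qed.

Lemma der_bound f f' a b c : der f f' -> a <= b ->
  (forall x, a < x -> x < b -> `|f' x| <= c) -> `|f b - f a| <= c * (b - a).
Proof.
move=> Hf ab P; have Hc := derZ c der_id.
have K1 := @der_le _ _ _ _ a b Hf Hc ab.
have K2 := @der_le _ _ _ _ a b (derN Hf) Hc ab.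
rewrite ler_norml; apply/andP; split.
  suff : - f b - - f a <= c * b - c * a by lra.
  apply: K2 => x ax xb; rewrite mulr1; have := P x ax xb; rewrite ler_norml => /andP[]; lra.
suff : f b - f a <= c * b - c * a by lra.
apply: K1 => x ax xb; rewrite mulr1; have := P x ax xb; rewrite ler_norml => /andP[]; lra.
Qed.

Lemma der_const f a b : der f (fun=> 0) -> f a = f b.
Proof. exact: is_derive_0_is_cst. Qed.

(** The function N(x) exp(-K (x - a)) - B x is nonincreasing, because the
    exponential is at most 1 to the right of a. *)
Lemma gronwall N N' K B a b : der N N' -> a <= b -> 0 <= K -> 0 <= B ->
  (forall x, a < x -> x < b -> N' x <= K * N x + B) ->
  N b <= (N a + B * (b - a)) * expR (K * (b - a)).
Proof.
move=> HN ab K0 B0 P.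
(* integrating factor *)
pose e x := expR (- (K * (x - a))).
have He : der e (fun x => e x * - K).
  apply: (der_ext (der_comp der_exp (derN (derZ K (derB der_id (der_cst a)))))) => x //.
  by rewrite subr0 mulr1.
have ea : e a = 1 by rewrite /e subrr mulr0 oppr0 expR0.
have := der_le (derM HN He) (derZ B der_id) ab; rewrite ea (mulr1 (N a)) => H.
have {H} : N b * e b - N a <= B * b - B * a.
  apply: H => x ax xb; have := P x ax xb.
  have e0 : 0 < e x by exact: expR_gt0.
  have e1 : e x <= 1 by rewrite -[leRHS]expR0 ler_expR oppr_le0 mulr_ge0// subr_ge0 ltW.
  rewrite mulr1 => {}H; have : (N' x - K * N x) * e x <= B * e x by rewrite ler_pM2r//; lra.
  have : B * e x <= B by rewrite ler_piMr.
  lra.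
move=> H; have -> : N b = (N b * e b) * expR (K * (b - a)).
  by rewrite /e -mulrA -expRD addNr expR0 mulr1.
by rewrite ler_pM2r ?expR_gt0//; lra.
Qed.

Lemma cont_bounded f a b : continuous f -> exists2 M : R, 0 < M &
  forall x, a <= x -> x <= b -> `|f x| <= M.
Proof.
move=> cf; have [ab|ba] := leP a b; last first.
  by exists 1 => // x ax xb; have := le_trans ax xb; rewrite leNgt ba.
have cn : continuous (fun x => `|f x|) by move=> x; apply: continuous_comp; [exact: cf|exact: norm_continuous].
have [c _ H] := EVT_max ab (cont_within (A:=_) cn).
exists (`|f c| + 1); first by rewrite ltr_wpDl.
move=> x ax xb; rewrite (le_trans (H x _)) ?lerDl// in_itv/= ax xb //.
Qed.

(** Lebesgue integrals are taken over intervals whose left end depends on x;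
    changing the left end changes the integral by a constant, which the
    subtraction of the value at 0 removes. *)
Lemma antider f : continuous f -> exists2 F, der F f & F 0 = 0.
Proof.
move=> cf.
pose P a x := (\int[lebesgue_measure]_(t in [set` `[a, x]]) (f t))%R.
have HP a x : a < x -> is_derive x (1:R) (P a) (f x).
  move=> ax; have xu : x < x + 1 by rewrite ltrDl.
  have [|d e] := continuous_FTC1_closed (f := f) (a := a) xu _ ax (cf x).
    apply: continuous_compact_integrable; first exact: segment_compact.
    exact: cont_within.
  by split => //; move: e; rewrite derive1E.
(* any left end below both x and 0 would do *)
pose F x := P (- `|x| - 1) x - P (- `|x| - 1) 0.
have lt0 x : - `|x| - 1 < 0 by have := normr_ge0 x; lra.
have ltx x : - `|x| - 1 < x by have := ler_norm (- x); rewrite normrN; lra.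
have indep a b x : a < x -> b < x -> a < 0 -> b < 0 -> P a x - P a 0 = P b x - P b 0.
  move=> ax bx a0 b0.
  pose m := Num.min x 0; pose M := Num.max x 0.
  have mM : m <= M by rewrite /m /M; case: (leP x 0) => h; lra.
  have am : a < m by rewrite /m lt_min ax a0.
  have bm : b < m by rewrite /m lt_min bx b0.
  have D t : m <= t -> is_derive t (1:R) (P a - P b) 0.
    move=> mt; have := HP a t (lt_le_trans am mt); have := HP b t (lt_le_trans bm mt) => ? ?.
    by rewrite -(subrr (f t)); exact: is_deriveB.
  have [||c _] := @MVT_segment R (P a - P b) (fun=> 0) m M mM.
  - move=> t; rewrite in_itv/= => /andP[h _]; apply: D; exact: ltW.
  - apply: derivable_within_continuous => t; rewrite in_itv/= => /andP[h _]; by case: (D t h).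
  rewrite mul0r => /eqP; rewrite subr_eq0 => /eqP; rewrite !fctE /M /m.
  by case: (leP x 0) => h e; [move: e|move: e]; lra.
exists F; last by rewrite /F subrr.
move=> x.
have [a [a0 aP]] : exists a, a < 0 /\ forall y, `|y - x| < 1 -> a < y.
  exists (- `|x| - 1); split => // y; rewrite ltr_norml => /andP[h _].
  have := ler_norm (- x); rewrite normrN; lra.
have ax : a < x by apply: aP; rewrite subrr normr0.
have Dx := HP a x ax.
have : is_derive x (1:R) (fun y => P a y - P a 0) (f x).
  by rewrite -(subr0 (f x)); apply: is_deriveB.
apply: near_eq_is_derive.
near=> y; rewrite /F; apply: indep => //; apply: aP.
by near: y; apply/nbhs_ballP; exists 1 => //= y; rewrite /ball/= distrC.
Unshelve. all: by end_near. Qed.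

End Calculus.

(** * Smooth functions of one variable *)

Section Smooth1.
Context {R : realType}.
Implicit Types (f g h : R -> R) (a b c x y : R).

Lemma der_unique f f' g' : der f f' -> der f g' -> f' = g'.
Proof. by move=> H1 H2; apply/funext => x; have [_ <-] := H1 x; have [_ <-] := H2 x. Qed.

(** k-fold differentiability. No continuity is asked of the last derivative:
    it is automatic for a function that satisfies this for all k. *)
Fixpoint kder k f : Prop :=
  if k is k'.+1 then exists2 f', der f f' & kder k' f' else True.

Definition smooth1 f := forall k, kder k f.

Lemma kder_pred k f : kder k.+1 f -> kder k f.
Proof. by elim: k f => // k IH f [f' d /IH H]; exists f'. Qed.

Lemma kder_cst k c : kder k (fun=> c).
Proof. by elim: k c => // k IH c; exists (fun=> 0); [exact: der_cst|exact: IH]. Qed.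

Lemma kderD k f g : kder k f -> kder k g -> kder k (fun x => f x + g x).
Proof.
elim: k f g => // k IH f g [f' df Hf] [g' dg Hg].
by eexists; [exact: derD df dg|exact: IH].
Qed.

Lemma kderM k f g : kder k f -> kder k g -> kder k (fun x => f x * g x).
Proof.
elim: k f g => // k IH f g Hf Hg.
have [f' df Hf'] := Hf; have [g' dg Hg'] := Hg.
eexists; first exact: derM df dg.
by apply: kderD; apply: IH => //; exact: kder_pred.
Qed.

Lemma kderN k f : kder k f -> kder k (fun x => - f x).
Proof. by elim: k f => // k IH f [f' df Hf]; eexists; [exact: derN df|exact: IH]. Qed.

Lemma kder_comp k f g : smooth1 f -> kder k g -> kder k (fun x => f (g x)).
Proof.
elim: k f g => // k IH f g Hf Hg; have [g' dg Hg'] := Hg.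
have [f' df _] := Hf 1%N.
eexists; first exact: der_comp df dg.
apply: kderM => //; apply: IH; last exact: kder_pred.
by move=> j; have [f2 df2 Hf2] := Hf j.+1; rewrite (der_unique df df2).
Qed.

Lemma kderV k f : (forall x, f x != 0) -> kder k f -> kder k (fun x => (f x)^-1).
Proof.
move=> f0; elim: k => // k IH Hf; have [f' df Hf'] := Hf.
eexists; first exact: derV f0 df.
have H := IH (kder_pred Hf).
by apply: kderM; [exact: kderN|exact: kderM].
Qed.

Lemma smooth1_der f f' : der f f' -> smooth1 f' -> smooth1 f.
Proof. by move=> d H [//|k]; exists f'. Qed.

Lemma smooth1_derivative f f' : der f f' -> smooth1 f -> smooth1 f'.
Proof. by move=> d H k; have [f2 d2 H2] := H k.+1; rewrite (der_unique d d2). Qed.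

Lemma smooth1_has_der f : smooth1 f -> exists2 f', der f f' & smooth1 f'.
Proof. by move=> H; have [f' d _] := H 1%N; exists f' => //; exact: smooth1_derivative d H. Qed.

Lemma smooth1_exp : smooth1 (@expR R).
Proof. by elim=> // k IH; exists (@expR R) => //; exact: der_exp. Qed.

Lemma kder_sincos k : kder k (@sin R) /\ kder k (@cos R).
Proof.
elim: k => // k [Is Ic]; split; first by exists (@cos R) => //; exact: der_sin.
by exists (fun x => - sin x); [exact: der_cos|exact: kderN].
Qed.

Lemma smooth1_id : smooth1 id.
Proof. by apply: smooth1_der der_id _ => k; exact: kder_cst. Qed.

Lemma smooth1_cont f : smooth1 f -> continuous f.
Proof. by move=> /(_ 1%N)[f' d _]; exact: der_cont d. Qed.

Lemma der_shift f f' T : der f f' -> der (fun x => f (x + T)) (fun x => f' (x + T)).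
Proof.
move=> d; apply: (der_eq (der_comp d (derD der_id (der_cst T)))) => x.
by rewrite addr0 mulr1.
Qed.

(** Derivatives are unique. *)
Lemma der_periodic f f' T : der f f' -> (forall x, f (x + T) = f x) ->
  forall x, f' (x + T) = f' x.
Proof.
move=> d H; have d2 := der_shift T d.
have e : (fun x => f (x + T)) = f by apply/funext.
by rewrite e in d2; move=> x; have := congr1 (fun g => g x) (der_unique d2 d).
Qed.

End Smooth1.

(** * Existence for linear second order equations *)

Section ODE.
Context {R : realType}.
Implicit Types (f g h F G : R -> R) (a b c x y : R).

Lemma le_geom_eq0 (x C : R) : 0 <= x -> (forall n, x <= C * (2^-1) ^+ n) -> x = 0.
Proof.
move=> x0 H; apply/eqP; rewrite eq_le x0 andbT leNgt; apply/negP => xp.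
have C0 : 0 <= C by have := H 0%N; rewrite expr0 mulr1; apply: le_trans.
have := archi_boundP (divr_ge0 C0 x0); set n := Num.bound _ => Hn.
have := H n; rewrite exprVn -/(_ / _) ler_pdivlMr ?exprn_gt0//.
rewrite leNgt => /negP; apply.
move: Hn; rewrite ltr_pdivrMr// => /lt_le_trans; apply.
rewrite mulrC ler_pM2l// -natrX ler_nat; exact/ltnW/ltn_expl.
Qed.

Let J g : R -> R := xget (fun=> 0) [set F | der F g /\ F 0 = 0].

Let JP g : continuous g -> der (J g) g /\ J g 0 = 0.
Proof.
move=> cg; rewrite /J; case: xgetP => [F _ []//|H].
by have [F d e] := antider cg; have := H F; case.
Qed.

Section picard.
Variables (W : R -> R) (M a b : R).
Hypotheses (cW : continuous W) (WM : forall x, `|W x| <= M).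

Let M0 : 0 <= M. Proof. exact: le_trans (WM 0). Qed.
Let c := 1 + 2 * M.
Let c0 : 0 < c. Proof. by rewrite /c; have := M0; lra. Qed.
Let ch x := expR (c * x) + expR (- c * x).
Let sh x := expR (c * x) - expR (- c * x).

Let ch0 x : 0 < ch x. Proof. by rewrite addr_gt0 ?expR_gt0. Qed.

Let der_ec k : der (fun x => expR (k * x)) (fun x => k * expR (k * x)).
Proof.
apply: (der_eq (der_comp (@der_exp R) (derZ k (@der_id R)))) => x.
by rewrite mulr1 mulrC.
Qed.

Let J_bound g G C : der G g -> G 0 = 0 -> (forall x, `|g x| <= C * ch x) ->
  forall x, `|G x| <= C / c * ch x.
Proof.
move=> dG G0 H x.
have C0 : 0 <= C by have := le_trans (normr_ge0 _) (H 0); rewrite pmulr_lge0.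
have dS : der (fun x => C / c * sh x) (fun x => C * ch x).
  apply: (der_eq (derZ (C / c) (derB (der_ec c) (der_ec (- c))))) => y.
  by rewrite /ch; field; exact: lt0r_neq0.
have s0 : sh 0 = 0 by rewrite /sh !mulr0 subrr.
have Cc : 0 <= C / c by rewrite divr_ge0// ltW.
have [x0|x0] := leP 0 x.
  have K1 : G x - G 0 <= C / c * sh x - C / c * sh 0.
    by apply: der_le dG dS x0 _ => y _ _; exact: le_trans (ler_norm _) (H y).
  have K2 : - G x - - G 0 <= C / c * sh x - C / c * sh 0.
    apply: der_le (derN dG) dS x0 _ => y _ _.
    by apply: le_trans (ler_norm _) _; rewrite normrN; exact: H.
  have K3 : C / c * sh x <= C / c * ch x.
    by apply: ler_wpM2l => //; rewrite /sh /ch; have := expR_gt0 (- c * x); lra.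
  rewrite ler_norml; apply/andP; split; rewrite G0 s0 in K1 K2; lra.
have {}x0 := ltW x0.
have K1 : G 0 - G x <= C / c * sh 0 - C / c * sh x.
  by apply: der_le dG dS x0 _ => y _ _; exact: le_trans (ler_norm _) (H y).
have K2 : - G 0 - - G x <= C / c * sh 0 - C / c * sh x.
  apply: der_le (derN dG) dS x0 _ => y _ _.
  by apply: le_trans (ler_norm _) _; rewrite normrN; exact: H.
have K3 : - (C / c * sh x) <= C / c * ch x.
  by rewrite -mulrN; apply: ler_wpM2l => //; rewrite /sh /ch; have := expR_gt0 (c * x); lra.
rewrite ler_norml; apply/andP; split; rewrite G0 s0 in K1 K2; lra.
Qed.

Let JJ g := J (J g).
Let JJP g : continuous g -> [/\ der (JJ g) (J g), der (J g) g, JJ g 0 = 0 & J g 0 = 0].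
Proof.
move=> cg; have [d e] := JP cg; have [d2 e2] := JP (der_cont d); by split.
Qed.

Let JJ_bound g1 g2 C : continuous g1 -> continuous g2 ->
  (forall x, `|g1 x - g2 x| <= C * ch x) ->
  forall x, `|JJ g1 x - JJ g2 x| <= C / c / c * ch x.
Proof.
move=> c1 c2 H.
have [d1 d1' e1 e1'] := JJP c1; have [d2 d2' e2 e2'] := JJP c2.
apply: (J_bound (derB d1 d2)); first by rewrite e1 e2 subrr.
by apply: (J_bound (derB d1' d2')) => //; rewrite e1' e2' subrr.
Qed.

Let contM f g : continuous f -> continuous g -> continuous (fun x => f x * g x).
Proof. by move=> cf cg x; apply: cvgM; [exact: cf|exact: cg]. Qed.

Let t0 x := a + b * x.
Let t := fix t n : R -> R :=
  if n is n'.+1 then (fun x => t0 x + JJ (fun y => W y * t n' y) x) else t0.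

Let d0 : der t0 (fun=> b).
Proof. by apply: (der_eq (derD (der_cst a) (derZ b (@der_id R)))) => x; rewrite add0r mulr1. Qed.

Let ct n : continuous (t n).
Proof.
elim: n => [|n IH]; first exact: der_cont d0.
have [d1 _ _ _] := JJP (contM cW IH).
exact: der_cont (derD d0 d1).
Qed.

Let A : R := `|a| + `|b|.
Let A0 : 0 <= A. Proof. by rewrite addr_ge0. Qed.

Let contr (C : R) : 0 <= C -> M * C / c / c <= C * 2^-1.
Proof.
move=> C0; rewrite ler_pdivrMr// ler_pdivrMr//.
have -> : C * 2^-1 * c * c = C * (2^-1 * c * c) by ring.
rewrite mulrC ler_wpM2l// /c; have := sqr_ge0 M; have := M0; lra.
Qed.

Let t0_bound x : `|t0 x| <= A * ch x.
Proof.
have chx : 1 + `|x| <= ch x.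
  have e1 := expR_ge1Dx (c * x); have e2 := expR_ge1Dx (- c * x).
  have p1 := expR_gt0 (c * x); have p2 := expR_gt0 (- c * x).
  have m := M0.
  rewrite /ch; case: (ler0P x) => h.
    have : M * x <= 0 by rewrite mulr_ge0_le0. rewrite /c in e1 e2 p1 p2 *; lra.
  have : 0 <= M * x by rewrite mulr_ge0// ltW. rewrite /c in e1 e2 p1 p2 *; lra.
apply: (@le_trans _ _ (A * (1 + `|x|))); last exact: ler_wpM2l.
rewrite /t0 /A; apply: le_trans (ler_normD _ _) _; rewrite normrM.
have h1 := normr_ge0 a; have h2 := normr_ge0 b; have h3 := normr_ge0 x.
have : 0 <= `|a| * `|x| by rewrite mulr_ge0. lra.
Qed.

Let step n x : `|t n.+1 x - t n x| <= A * (2^-1) ^+ n * ch x.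
Proof.
elim: n x => [|n IH] x.
  rewrite expr0 mulr1 /= addrC addKr.
  have [d1 d1' e1 e1'] := JJP (contM cW (@ct 0%N)).
  apply: (@le_trans _ _ (M * A / c / c * ch x)).
    apply: (J_bound d1 e1) => {}x; apply: (J_bound d1' e1') => {}x.
    by rewrite normrM -mulrA ler_pM.
  apply: ler_wpM2r; first exact: ltW. apply: le_trans (contr A0) _; have := A0; lra.
have -> : t n.+2 x - t n.+1 x = JJ (fun y => W y * t n.+1 y) x - JJ (fun y => W y * t n y) x.
  by rewrite [t n.+2 _]/= [t n.+1 x]/=; ring.
have A2 : 0 <= A * 2^-1 ^+ n by rewrite mulr_ge0 ?exprn_ge0// invr_ge0.
apply: (@le_trans _ _ (M * (A * 2^-1 ^+ n) / c / c * ch x)).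
  apply: JJ_bound; [exact: contM|exact: contM|move=> y].
  by rewrite -mulrBr normrM -[leRHS]mulrA; apply: ler_pM.
apply: ler_wpM2r; [exact: ltW|apply: le_trans (contr A2) _; rewrite exprSr mulrA]; by [].
Qed.

Let e n : R := (2^-1) ^+ n.
Let e0 n : 0 < e n. Proof. by rewrite exprn_gt0// invr_gt0. Qed.
Let eS n : e n.+1 = e n / 2. Proof. by rewrite /e exprSr. Qed.

Let tail n k x : `|t (n + k)%N x - t n x| <= 2 * A * (e n - e (n + k)%N) * ch x.
Proof.
elim: k => [|k IH]; first by rewrite addn0 !subrr normr0 mulr0 mul0r.
rewrite addnS; have := step (n + k) x; have := eS (n + k).
rewrite -/(e (n + k)) => -> H.
have -> : t (n + k).+1 x - t n x = (t (n + k).+1 x - t (n + k)%N x) + (t (n + k)%N x - t n x) by ring.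
apply: le_trans (ler_normD _ _) _; apply: le_trans (lerD H IH) _.
rewrite /e; lra.
Qed.

Let tail2 n m x : `|t n x - t m x| <= 2 * A * (e n + e m) * ch x.
Proof.
have A0' := A0; have c0' := ltW (ch0 x).
have K i j : (i <= j)%N -> `|t j x - t i x| <= 2 * A * (e i + e j) * ch x.
  move=> ij; rewrite -(subnKC ij); apply: le_trans (tail _ _ _) _.
  rewrite ler_wpM2r// ler_wpM2l// ?mulr_ge0//.
  have := e0 (i + (j - i)); lra.
case/orP: (leq_total n m) => h; first by rewrite distrC; exact: K.
by rewrite (addrC (e n)); exact: K.
Qed.

(* The limit of the iterates, as the supremum of lower bounds: the tail after step
   n is at most 2 A e n ch x. *)
Let F x : R := sup [set t n x - 2 * A * e n * ch x | n in setT].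

Let F_bound n x : `|F x - t n x| <= 2 * A * e n * ch x.
Proof.
have ub : ubound [set t n x - 2 * A * e n * ch x | n in setT] (t n x + 2 * A * e n * ch x).
  move=> _ [m _ <-]; have := ler_norm (t m x - t n x); have := tail2 m n x; lra.
have h1 : F x <= t n x + 2 * A * e n * ch x.
  by apply: ge_sup => //; exists (t 0%N x - 2 * A * e 0%N * ch x); exists 0%N.
have h2 : t n x - 2 * A * e n * ch x <= F x.
  by apply: ub_le_sup; [exists (t n x + 2 * A * e n * ch x)|exists n].
by rewrite ler_norml; apply/andP; split; lra.
Qed.

Let cF : continuous F.
Proof.
move=> x; apply/cvgrPdist_lt => eps eps0.
have cch : continuous ch by exact: der_cont (derD (der_ec c) (der_ec (- c))).
have [B B0 HB] := cont_bounded (x - 1) (x + 1) cch.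
have [n Hn] : exists n, 2 * A * e n * B < eps / 3.
  apply: contrapT => /forallNP H.
  have : eps / 3 = 0.
    apply: (@le_geom_eq0 _ (2 * A * B)); first lra.
    by move=> n; have := H n => /negP; rewrite -leNgt /e; lra.
  lra.
have HB' y : x - 1 <= y -> y <= x + 1 -> `|F y - t n y| < eps / 3.
  move=> h1 h2; apply: le_lt_trans (F_bound n y) _; apply: le_lt_trans Hn.
  apply: ler_wpM2l; first by rewrite !mulr_ge0// ltW.
  by apply: le_trans (ler_norm _) _; exact: HB.
have /cvgrPdist_lt/(_ (eps / 3)) := @ct n x => /(_ ltac:(lra)) Ht.
near=> y.
have hy : `|x - y| < 1.
  by near: y; apply/nbhs_ballP; exists 1 => /=.
have h1 : `|F x - t n x| < eps / 3 by apply: HB'; lra.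
have h2 : `|F y - t n y| < eps / 3.
  by move: hy; rewrite ltr_norml => /andP[? ?]; apply: HB'; lra.
have h3 : `|t n x - t n y| < eps / 3 by near: y.
have -> : F x - F y = (F x - t n x) + (t n x - t n y) - (F y - t n y) by ring.
apply: le_lt_trans (ler_normB _ _) _.
have := ler_normD (F x - t n x) (t n x - t n y); lra.
Unshelve. all: by end_near. Qed.

Let F_fix x : F x = t0 x + JJ (fun y => W y * F y) x.
Proof.
suff : `|F x - (t0 x + JJ (fun y => W y * F y) x)| = 0.
  by move/eqP; rewrite normr_eq0 subr_eq0 => /eqP.
apply: (@le_geom_eq0 _ (2 * A * ch x)) => // n.
have K1 := F_bound n.+1 x.
have K2 : `|JJ (fun y => W y * F y) x - JJ (fun y => W y * t n y) x|
    <= M * (2 * A * e n) / c / c * ch x.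
  apply: JJ_bound; [exact: contM|exact: contM|move=> y].
  by rewrite -mulrBr normrM -[leRHS]mulrA; apply: ler_pM.
have K3 : M * (2 * A * e n) / c / c * ch x <= 2 * A * e n * 2^-1 * ch x.
  apply: ler_wpM2r; [exact: ltW|apply: contr].
    by rewrite !mulr_ge0// ltW.
have -> : F x - (t0 x + JJ (fun y => W y * F y) x) =
   (F x - t n.+1 x) - (JJ (fun y => W y * F y) x - JJ (fun y => W y * t n y) x).
  by rewrite [t n.+1 x]/=; ring.
apply: le_trans (ler_normB _ _) _; apply: le_trans (lerD K1 (le_trans K2 K3)) _.
rewrite eS -/(e n); lra.
Qed.

(** Picard iteration on the whole line. With the weight exp(c x) + exp(- c x),
    two antiderivatives of a bounded multiple of the weight gain a factor
    1/c^2, so for c = 1 + 2 M the iteration contracts by 1/2. *)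
Lemma sol_exists : exists F F' : R -> R, [/\ der F F',
  der F' (fun x => W x * F x), F 0 = a & F' 0 = b].
Proof.
have [d1 d1' e1 e1'] := JJP (contM cW cF).
exists F, (fun x => b + J (fun y => W y * F y) x).
split.
- by apply: (der_ext (derD d0 d1)) => // x; rewrite F_fix.
- by apply: (der_eq (derD (der_cst b) d1')) => x; rewrite add0r.
- by rewrite F_fix e1 /t0 mulr0 !addr0.
- by rewrite e1' addr0.
Qed.

End picard.
End ODE.

(** * Uniqueness, Wronskian and monodromy *)

Section LinearODE.
Context {R : realType}.
Implicit Types (W F G Q : R -> R) (a b x y T : R).

(** F' is kept as a separate function so that the equation is first order in
    the pair (F, F'). *)
Definition sol W F F' := der F F' /\ der F' (fun x => W x * F x).

Lemma sol_lin W F F' G G' a b : sol W F F' -> sol W G G' ->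
  sol W (fun x => a * F x + b * G x) (fun x => a * F' x + b * G' x).
Proof.
move=> [d1 d1'] [d2 d2']; split; first exact: derD (derZ a d1) (derZ b d2).
by apply: (der_eq (derD (derZ a d1') (derZ b d2'))) => x; ring.
Qed.

Lemma sol_shift W F F' T : (forall x, W (x + T) = W x) -> sol W F F' ->
  sol W (fun x => F (x + T)) (fun x => F' (x + T)).
Proof.
move=> WT [d d']; split; first exact: der_shift.
by apply: (der_eq (der_shift T d')) => x /=; rewrite WT.
Qed.

(** Gronwall for F^2 + F'^2, whose derivative is at most 1 + M times
    itself. *)
Lemma sol_unique_pos W M F F' : (forall x, `|W x| <= M) -> sol W F F' ->
  F 0 = 0 -> F' 0 = 0 -> forall x, 0 <= x -> F x = 0.
Proof.
move=> WM [d d'] F0 F'0 x x0.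
have M0 : 0 <= M by exact: le_trans (WM 0).
pose N y := F y * F y + F' y * F' y.
have dN : der N (fun y => 2 * (1 + W y) * (F y * F' y)).
  by apply: (der_eq (derD (derM d d) (derM d' d'))) => y; ring.
have K1 : 0 <= 1 + M by lra.
have := gronwall dN x0 K1 (lexx 0) _.
have N0 : N 0 = 0 by rewrite /N F0 F'0 !mul0r addr0.
rewrite N0 mul0r addr0 mul0r => H.
have : N x <= 0.
  apply: H => y _ _; rewrite addr0.
  have W1 := WM y; rewrite ler_norml in W1; case/andP: W1 => W1 W2.
  have S1 : 0 <= (F y + F' y) ^+ 2 by exact: sqr_ge0.
  have S2 : 0 <= (F y - F' y) ^+ 2 by exact: sqr_ge0.
  rewrite /N; have [h|h] := leP 0 (F y * F' y).
    have : (1 + W y) * (F y * F' y) <= (1 + M) * (F y * F' y) by rewrite ler_wpM2r//; lra.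
    have : (1 + M) * (2 * (F y * F' y)) <= (1 + M) * (F y * F y + F' y * F' y) by rewrite ler_wpM2l//; lra.
    lra.
  have : (1 + W y) * (F y * F' y) <= (1 + M) * - (F y * F' y).
    have : 0 <= (2 + W y + M) * - (F y * F' y) by rewrite mulr_ge0//; lra.
    lra.
  have : (1 + M) * (2 * - (F y * F' y)) <= (1 + M) * (F y * F y + F' y * F' y) by rewrite ler_wpM2l//; lra.
  lra.
rewrite /N => Nx; have h1 := sqr_ge0 (F x); have h2 := sqr_ge0 (F' x).
by apply/eqP; rewrite -sqrf_eq0 eq_le h1 andbT; lra.
Qed.

(** The reflected function x |-> F(-x) solves the equation with the reflected
    potential. *)
Lemma sol_unique W M F F' : (forall x, `|W x| <= M) -> sol W F F' ->
  F 0 = 0 -> F' 0 = 0 -> forall x, F x = 0.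
Proof.
move=> WM [d d'] F0 F'0 x; have [x0|/ltW x0] := leP 0 x.
  by apply: sol_unique_pos WM (conj d d') _ _ _ _.
have dN := derN (@der_id R).
have S : sol (fun y => W (- y)) (fun y => F (- y)) (fun y => - F' (- y)).
  split; first by apply: (der_eq (der_comp d dN)) => y; rewrite mulrN1.
  by apply: (der_eq (derN (der_comp d' dN))) => y /=; ring.
rewrite -(opprK x); apply: (sol_unique_pos (fun y => WM (- y)) S).
- by rewrite oppr0.
- by rewrite oppr0 F'0 oppr0.
- by rewrite oppr_ge0.
Qed.

Lemma sol_expand W M c c' s s' F F' : (forall x, `|W x| <= M) ->
  sol W c c' -> sol W s s' -> c 0 = 1 -> c' 0 = 0 -> s 0 = 0 -> s' 0 = 1 ->
  sol W F F' -> forall x, F x = F 0 * c x + F' 0 * s x.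
Proof.
move=> WM Sc Ss c0 c'0 s0 s'0 SF x.
have S := sol_lin 1 (-1) SF (sol_lin (F 0) (F' 0) Sc Ss).
have H := sol_unique WM S.
have : 1 * F x + -1 * (F 0 * c x + F' 0 * s x) = 0.
  by apply: H => /=; rewrite ?c0 ?c'0 ?s0 ?s'0; ring.
lra.
Qed.

Lemma sol_expand' W M c c' s s' F F' : (forall x, `|W x| <= M) ->
  sol W c c' -> sol W s s' -> c 0 = 1 -> c' 0 = 0 -> s 0 = 0 -> s' 0 = 1 ->
  sol W F F' -> forall x, F' x = F 0 * c' x + F' 0 * s' x.
Proof.
move=> WM Sc Ss c0 c'0 s0 s'0 SF x.
have E : F = (fun x => F 0 * c x + F' 0 * s x).
  by apply/funext => y; exact: sol_expand WM Sc Ss c0 c'0 s0 s'0 SF y.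
have [d _] := SF; rewrite {1}E in d.
have [d2 _] := sol_lin (F 0) (F' 0) Sc Ss.
exact: (congr1 (fun f => f x) (der_unique d d2)).
Qed.

(** The Wronskian is constant because the equation has no first order term. *)
Lemma wronskian W c c' s s' : sol W c c' -> sol W s s' ->
  c 0 = 1 -> c' 0 = 0 -> s 0 = 0 -> s' 0 = 1 ->
  forall x, c x * s' x - c' x * s x = 1.
Proof.
move=> [d1 d1'] [d2 d2'] c0 c'0 s0 s'0 x.
have D : der (fun x => c x * s' x - c' x * s x) (fun=> 0).
  by apply: (der_eq (derB (derM d1 d2') (derM d1' d2))) => y; ring.
by rewrite (der_const x 0 D) c0 c'0 s0 s'0; ring.
Qed.

(** By Cayley-Hamilton a matrix of determinant 1 and trace -1 satisfies M^2 +
    M + 1 = 0. Thus F(x + 2T) + F(x + T) + F(x), a solution with zero data at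
    0, vanishes identically; comparing this identity at x and x + T gives the
    period 3T. *)
Lemma sol_period3 W M c c' s s' F F' T : (forall x, `|W x| <= M) ->
  (forall x, W (x + T) = W x) ->
  sol W c c' -> sol W s s' -> c 0 = 1 -> c' 0 = 0 -> s 0 = 0 -> s' 0 = 1 ->
  c T + s' T = -1 -> sol W F F' -> forall x, F (x + T *+ 3) = F x.
Proof.
move=> WM WT Sc Ss c0 c'0 s0 s'0 tr SF x.
have S1 := sol_shift WT SF; have S2 := sol_shift WT S1; rewrite /= in S2.
have SH := sol_lin 1 1 (sol_lin 1 1 S2 S1) SF.
have e1 := sol_expand WM Sc Ss c0 c'0 s0 s'0 SF T.
have e1' := sol_expand' WM Sc Ss c0 c'0 s0 s'0 SF T.
have e2 := sol_expand WM Sc Ss c0 c'0 s0 s'0 S1 T.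
have e2' := sol_expand' WM Sc Ss c0 c'0 s0 s'0 S1 T.
have w := wronskian Sc Ss c0 c'0 s0 s'0 T.
rewrite /= add0r in e2 e2'.
have es : s' T = - 1 - c T by lra.
have K y : F (y + T + T) + F (y + T) + F y = 0.
  have H := sol_unique WM SH.
  have : 1 * (1 * F (y + T + T) + 1 * F (y + T)) + 1 * F y = 0; last lra.
  apply: H => /=; rewrite !add0r ?e2 ?e2' e1 e1' es.
    rewrite es in w; have : c' T * s T = c T * (-1 - c T) - 1 by lra.
    move=> w2; transitivity (F 0 * (c T * c T + c' T * s T + c T + 1)); first by ring.
    by rewrite w2; ring.
  rewrite es in w; have : c' T * s T = c T * (-1 - c T) - 1 by lra.
  move=> w2; transitivity (F' 0 * (c' T * s T + (1 + c T) * (1 + c T) - c T)); first by ring.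
  by rewrite w2; ring.
have := K x; have := K (x + T) => h1 h2.
have -> : x + T *+ 3 = x + T + T + T by ring.
lra.
Qed.

End LinearODE.

(** * Dependence on the spectral parameter *)

Section SpectralParameter.
Context {R : realType}.
Variables (Q : R -> R) (k T q1 : R).
Hypotheses (Qc : continuous Q) (Q1 : forall x, `|Q x| <= q1) (T0 : 0 < T).

Definition potential (l x : R) := k ^+ 2 - l * Q x.

Lemma potential_cont l : continuous (potential l).
Proof.
move=> x; apply: cvgB; first exact: cvg_cst.
by apply: cvgM; [exact: cvg_cst|exact: Qc].
Qed.

Lemma potential_bound l x : `|potential l x| <= k ^+ 2 + `|l| * q1.
Proof.
apply: le_trans (ler_normB _ _) _.
by rewrite (ger0_norm (sqr_ge0 k)) (normrM l) lerD2l ler_wpM2l.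
Qed.

(** The difference d of two solutions solves the equation with right-hand side
    (l - m) Q F, and Gronwall for d^2 + d'^2 makes it Lipschitz in the
    parameter, locally. *)
Lemma sol_param_cont (F F' : R -> R -> R) a b : (forall l, sol (potential l) (F l) (F' l)) ->
  (forall l, F l 0 = a) -> (forall l, F' l 0 = b) ->
  continuous (fun l => F l T) /\ continuous (fun l => F' l T).
Proof.
move=> SF Fa F'b.
suff H m : exists2 C, 0 < C & forall l, `|m - l| < 1 ->
    `|F m T - F l T| <= C * `|m - l| /\ `|F' m T - F' l T| <= C * `|m - l|.
  split=> m; have [C C0 HC] := H m; apply/cvgrPdist_lt => e e0;
    near=> l; (have h1 : `|m - l| < 1
      by near: l; apply/nbhs_ballP; exists 1 => /=);
    (have h2 : `|m - l| < e / C
      by near: l; apply/nbhs_ballP; exists (e / C) => /=; [rewrite divr_gt0|]);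
    rewrite ltr_pdivlMr// mulrC in h2; apply: le_lt_trans h2; by have [] := HC l h1.
have sqn (u : R) : `|u| ^+ 2 = u ^+ 2 by rewrite real_normK ?num_real.
have [dm dm'] := SF m.
have [B B0 HB] := cont_bounded 0 T (der_cont dm).
have q0 : 0 <= q1 by exact: le_trans (Q1 0).
pose Mw := k ^+ 2 + (`|m| + 1) * q1.
have Mw0 : 0 <= Mw by rewrite addr_ge0 ?sqr_ge0// mulr_ge0// addr_ge0.
pose E := expR ((2 + Mw) * T).
have E0 : 0 < E by exact: expR_gt0.
(* C >= 1 ensures C <= C^2, so that the bound on squares gives one on d and d' *)
pose C := 1 + (q1 * B) ^+ 2 * T * E.
have C1 : 1 <= C by rewrite lerDl !mulr_ge0 ?sqr_ge0// ltW.
exists C; first lra.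
move=> l ml; have [dl dl'] := SF l.
pose d x := F m x - F l x; pose d' x := F' m x - F' l x.
have dd : der d d' by exact: derB.
have dd' : der d' (fun x => potential l x * d x + (l - m) * (Q x * F m x)).
  by apply: (der_eq (derB dm' dl')) => x; rewrite /potential /d; ring.
pose N x := d x * d x + d' x * d' x.
have dN : der N (fun x => 2 * (1 + potential l x) * (d x * d' x) + 2 * d' x * ((l - m) * (Q x * F m x))).
  by apply: (der_eq (derD (derM dd dd) (derM dd' dd'))) => x; ring.
have lm : `|l| <= `|m| + 1.
  have -> : l = m - (m - l) by ring.
  by apply: le_trans (ler_normB _ _) _; rewrite lerD2l ltW.
have Wl x : `|potential l x| <= Mw.
  by apply: le_trans (potential_bound l x) _; rewrite lerD2l ler_wpM2r.
have N0 : N 0 = 0 by rewrite /N /d /d' !Fa !F'b !subrr mul0r addr0.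
pose Z := ((m - l) * (q1 * B)) ^+ 2.
have Z0 : 0 <= Z by exact: sqr_ge0.
have := gronwall dN (ltW T0) (_ : 0 <= 2 + Mw) Z0 _.
rewrite N0 add0r subr0 -/E => H.
have {}H : N T <= Z * T * E.
  apply: H; first by rewrite addr_ge0.
  move=> x x0 xT.
  have := Wl x; rewrite ler_norml => /andP[W1 W2].
  have S1 : 0 <= (d x + d' x) ^+ 2 by exact: sqr_ge0.
  have S2 : 0 <= (d x - d' x) ^+ 2 by exact: sqr_ge0.
  have I1 : 2 * (1 + potential l x) * (d x * d' x) <= (1 + Mw) * N x.
    rewrite /N; have [h|h] := leP 0 (d x * d' x).
      have : (1 + potential l x) * (d x * d' x) <= (1 + Mw) * (d x * d' x) by rewrite ler_wpM2r//; lra.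
      have : (1 + Mw) * (2 * (d x * d' x)) <= (1 + Mw) * (d x * d x + d' x * d' x) by rewrite ler_wpM2l//; lra.
      lra.
    have : (1 + potential l x) * (d x * d' x) <= (1 + Mw) * - (d x * d' x).
      have : 0 <= (2 + potential l x + Mw) * - (d x * d' x) by rewrite mulr_ge0//; lra.
      lra.
    have : (1 + Mw) * (2 * - (d x * d' x)) <= (1 + Mw) * (d x * d x + d' x * d' x) by rewrite ler_wpM2l//; lra.
    lra.
  set G := (l - m) * (Q x * F m x).
  have I2 : G ^+ 2 <= Z.
    rewrite -[G ^+ 2]sqn /Z -[leRHS]sqn ler_sqr ?nnegrE ?normr_ge0//.
    rewrite /G !normrM distrC ler_wpM2l// ler_pM//; last first.
      by apply: le_trans (HB x _ _) (ler_norm _); exact: ltW.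
    by apply: le_trans (Q1 x) (ler_norm _).
  have I3 : 0 <= (d' x - G) ^+ 2 by exact: sqr_ge0.
  have I4 : 0 <= d x ^+ 2 by exact: sqr_ge0.
  rewrite /N in I1 *; lra.
have NC : N T <= (C * `|m - l|) ^+ 2.
  apply: le_trans H _; rewrite exprMn real_normK ?num_real// mulrC.
  have -> : E * (Z * T) = ((q1 * B) ^+ 2 * T * E) * (m - l) ^+ 2 by rewrite /Z; ring.
  rewrite ler_wpM2r ?sqr_ge0//.
  have : C <= C ^+ 2 by rewrite expr2 ler_peMr//; lra.
  by rewrite /C; lra.
have Cp : 0 <= C * `|m - l| by rewrite mulr_ge0//; lra.
have sq (u : R) : u ^+ 2 <= N T -> `|u| <= C * `|m - l|.
  by move=> h; rewrite -ler_sqr ?nnegrE// sqn; exact: le_trans h NC.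
have h1 := sqr_ge0 (d T); have h2 := sqr_ge0 (d' T).
by split; apply: sq; rewrite /N -/(d T) -/(d' T); lra.
Unshelve. all: by end_near. Qed.

End SpectralParameter.

(** * Spectral parameters with monodromy of order three *)

Section Trace.
Context {R : realType}.
Variables (Q : R -> R) (k T q1 : R).
Hypotheses (Qs : smooth1 Q) (Q1 : forall x, `|Q x| <= q1) (T0 : 0 < T).
Hypotheses (Qpos : forall x, 0 < Q x) (QT : forall x, Q (x + T) = Q x).
Hypotheses (Q01 : Q 0 = 1) (Qd0 : forall Q', der Q Q' -> Q' 0 = 0).

Lemma der_ln_comp (f f' : R -> R) : (forall x, 0 < f x) -> der f f' ->
  der (fun x => ln (f x)) (fun x => (f x)^-1 * f' x).
Proof.
move=> f0 d x; have := is_derive1_ln (f0 x) => H; have := d x => ?.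
exact: is_derive1_comp.
Qed.

(** A = Q^(-1/4) is the WKB amplitude. It has A = 1 and A' = 0 at both ends of
    the period, which makes the WKB coordinates agree there with the Cauchy
    data. *)
Lemma wkb_amplitude : exists A A' A'' : R -> R, [/\ der A A', der A' A'', continuous A'' &
  [/\ forall x, 0 < A x, forall x, Q x * A x ^+ 4 = 1,
      A 0 = 1 /\ A T = 1 & A' 0 = 0 /\ A' T = 0]].
Proof.
have [Q' dQ _] := smooth1_has_der Qs.
pose A x := expR (- (4^-1) * ln (Q x)).
have dA := der_comp (@der_exp R) (derZ (- 4^-1) (der_ln_comp Qpos dQ)).
rewrite -/A in dA.
have sA : smooth1 A.
  move=> j; apply: (kder_comp (@smooth1_exp R)); apply: kderM; first exact: kder_cst.
  apply: (smooth1_der (der_ln_comp Qpos dQ)) => {}j.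
  apply: kderM; last exact: smooth1_derivative dQ Qs _.
  by apply: kderV => // x; exact: lt0r_neq0.
have [A' dA' sA'] := smooth1_has_der sA.
have [A'' dA'' sA''] := smooth1_has_der sA'.
have A0 : A 0 = 1 by rewrite /A Q01 ln1 mulr0 expR0.
have AT x : A (x + T) = A x by rewrite /A QT.
have A'0 : A' 0 = 0 by rewrite (der_unique dA' dA) (Qd0 dQ) !mulr0.
have A'T := der_periodic dA' AT.
exists A, A', A''; split => //; first exact: smooth1_cont.
split => //.
- by move=> x; exact: expR_gt0.
- move=> x; rewrite /A -expRM_natl.
  have -> : 4%:R * (- 4^-1 * ln (Q x)) = - ln (Q x) by field.
  by rewrite expRN lnK ?posrE// divff// lt0r_neq0.
- by have := AT 0; rewrite add0r A0.
- by have := A'T 0; rewrite add0r A'0.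
Qed.

Lemma cos_natpi m : cos (m%:R * pi) = (-1) ^+ m :> R.
Proof.
elim: m => [|m IH]; first by rewrite mul0r cos0.
by rewrite -natr1 mulrDl mul1r cosDpi IH exprS mulN1r.
Qed.

Lemma sin_natpi m : sin (m%:R * pi) = 0 :> R.
Proof.
elim: m => [|m IH]; first by rewrite mul0r sin0.
by rewrite -natr1 mulrDl mul1r sinDpi IH oppr0.
Qed.

(** In the coordinates y = F / A, p = (F' A - F A') / w the equation is a
    rotation of speed w / A^2 perturbed by a term of size 1/w. After undoing
    the rotation by the angle w theta, the solution moves by O(1/w) over a
    period, and at the chosen frequencies the rotation over a period is by the
    angle m pi. *)
Lemma monodromy_wkb : exists2 th, 0 < th & exists2 C, 0 < C &
  forall w m F F', 1 <= w -> w * th = m%:R * pi -> sol (potential Q k (w ^+ 2)) F F' ->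
  F 0 ^+ 2 + (F' 0 / w) ^+ 2 <= 1 ->
  `|(-1) ^+ m * F T - F 0| <= C / w /\ `|(-1) ^+ m * (F' T / w) - F' 0 / w| <= C / w.
Proof.
have [A [A' [A'' [dA dA' cA'' [Ap QA [A0 AT] [A'0 A'T]]]]]] := wkb_amplitude.
have An x : A x != 0 by exact: lt0r_neq0.
pose B x := (A x)^-1 * (A x)^-1.
have dB : exists B', der B B' by eexists; exact: derM (derV An dA) (derV An dA).
have [B' {}dB] := dB.
have [theta dth th0] := antider (der_cont dB).
have cA := der_cont dA.
have [MA MA0 HMA] := cont_bounded 0 T cA.
pose e x := k ^+ 2 * A x * A x - A x * A'' x.
have ce : continuous e.
  move=> x; apply: cvgB; apply: cvgM; [apply: cvgM; [exact: cvg_cst|exact: cA]|exact: cA|exact: cA|exact: cA''].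
have [K K0 HK] := cont_bounded 0 T ce.
exists (theta T).
  have H : MA^-1 * MA^-1 * T - MA^-1 * MA^-1 * 0 <= theta T - theta 0.
    apply: (der_le (derZ (MA^-1 * MA^-1) (@der_id R)) dth (ltW T0)) => x x0 xT.
    have AM : A x <= MA by apply: le_trans (ler_norm _) (HMA x _ _); exact: ltW.
    have iA : MA^-1 <= (A x)^-1 by rewrite lef_pV2 ?posrE.
    have i0 : 0 <= MA^-1 by rewrite invr_ge0 ltW.
    by rewrite mulr1 /B ler_pM.
  rewrite mulr0 subr0 th0 subr0 in H.
  by apply: lt_le_trans H; rewrite !mulr_gt0// invr_gt0.
pose E := expR (K * T).
have E0 : 0 < E by exact: expR_gt0.
(* E bounds the energy y^2 + p^2, hence 1 + E bounds y *)
exists (K * (1 + E) * T); first by rewrite !mulr_gt0// addr_gt0.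
move=> w m F F' w1 wth [dF dF'] N01.
have w0 : 0 < w by lra.
have wn : w != 0 by exact: lt0r_neq0.
pose y x := F x * (A x)^-1; pose p x := w^-1 * (F' x * A x - F x * A' x).
have dy : der y (fun x => w * B x * p x).
  apply: (der_eq (derM dF (derV An dA))) => x; rewrite /p /B.
  by field; rewrite wn An.
have dp : der p (fun x => - w * B x * y x + w^-1 * e x * y x).
  apply: (der_eq (derZ w^-1 (derB (derM dF' dA) (derM dF dA')))) => x.
  have := QA x; rewrite /potential /y /B /e => h.
  have -> : Q x = (A x) ^- 4.
    by apply: (mulIf (expf_neq0 4 (An x))); rewrite h mulVf// expf_neq0.
  by field; rewrite wn An.
pose N x := y x * y x + p x * p x.
have dN : der N (fun x => 2 * w^-1 * e x * (y x * p x)).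
  by apply: (der_eq (derD (derM dy dy) (derM dp dp))) => x; ring.
have y0 : y 0 = F 0 by rewrite /y A0 invr1 mulr1.
have p0 : p 0 = F' 0 / w by rewrite /p A0 A'0 mulr0 subr0 mulr1 mulrC.
have yT : y T = F T by rewrite /y AT invr1 mulr1.
have pT : p T = F' T / w by rewrite /p AT A'T mulr0 subr0 mulr1 mulrC.
have wi : w^-1 <= 1 by rewrite invf_le1.
have wi0 : 0 < w^-1 by rewrite invr_gt0.
have Nx x : 0 <= x -> x <= T -> N x <= E.
  move=> x0 xT.
  have := gronwall dN x0 (ltW K0) (lexx 0) _; rewrite mul0r addr0 subr0 => H.
  have N0 : N 0 <= 1 by rewrite /N y0 p0 -!expr2.
  apply: le_trans (H _) _; last first.
    rewrite -[leRHS]mul1r ler_pM ?expR_ge0//; last by rewrite ler_expR ler_wpM2l// ltW.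
    by rewrite /N; have := sqr_ge0 (y 0); have := sqr_ge0 (p 0); lra.
  move=> t t0 tx; rewrite addr0.
  have eK := HK t (ltW t0) (ltW (lt_le_trans tx xT)).
  have : `|2 * w^-1 * e t * (y t * p t)| <= K * (2 * `|y t * p t|).
    rewrite (normrM _ (y t * p t)) (normrM _ (e t)) (ger0_norm (_ : 0 <= 2 * w^-1)); last first.
      by rewrite mulr_ge0// ltW.
    have h1 : w^-1 * `|e t| <= 1 * K by rewrite ler_pM// ltW.
    rewrite [leRHS]mulrA; apply: ler_wpM2r => //; lra.
  move=> h1; apply: le_trans (ler_norm _) (le_trans h1 _).
  apply: ler_wpM2l; first exact: ltW.
  rewrite /N; have := sqr_ge0 (y t - p t); have := sqr_ge0 (y t + p t).
  by case: (ger0P (y t * p t)); lra.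
pose Y x := y x * cos (w * theta x) - p x * sin (w * theta x).
pose P x := y x * sin (w * theta x) + p x * cos (w * theta x).
have dc := der_comp (@der_cos R) (derZ w dth).
have ds := der_comp (@der_sin R) (derZ w dth).
have dY : der Y (fun x => - (w^-1 * e x * y x) * sin (w * theta x)).
  by apply: (der_eq (derB (derM dy dc) (derM dp ds))) => x; ring.
have dP : der P (fun x => (w^-1 * e x * y x) * cos (w * theta x)).
  by apply: (der_eq (derD (derM dy ds) (derM dp dc))) => x; ring.
have bd (tr : R -> R) x : (forall z, `|tr z| <= 1) -> 0 < x -> x < T ->
    `|w^-1 * e x * y x * tr (w * theta x)| <= K * (1 + E) / w.
  move=> Htr x0 xT; rewrite (normrM _ (tr _)) (normrM _ (y x)) (normrM _ (e x)) (ger0_norm (ltW wi0)).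
  have -> : K * (1 + E) / w = w^-1 * K * (1 + E) * 1 by ring.
  have h1 : w^-1 * `|e x| <= w^-1 * K by rewrite ler_pM2l// HK ?ltW.
  have h2 : `|y x| <= 1 + E.
    have := Nx x (ltW x0) (ltW xT); rewrite /N => h.
    have : 0 <= (1 - `|y x|) ^+ 2 by exact: sqr_ge0.
    have : `|y x| ^+ 2 = y x ^+ 2 by rewrite real_normK ?num_real.
    have := sqr_ge0 (p x); have := normr_ge0 (y x).
    lra.
  have h12 : w^-1 * `|e x| * `|y x| <= w^-1 * K * (1 + E).
    by apply: ler_pM => //; rewrite mulr_ge0// ltW.
  by apply: ler_pM => //; rewrite !mulr_ge0// ltW.
have HY := der_bound dY (ltW T0) (c := K * (1 + E) / w) _.
have HP := der_bound dP (ltW T0) (c := K * (1 + E) / w) _.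
rewrite subr0 in HY HP.
have eC : K * (1 + E) * T / w = K * (1 + E) / w * T by ring.
have YT : Y T = (-1) ^+ m * F T.
  by rewrite /Y wth cos_natpi sin_natpi mulr0 subr0 yT mulrC.
have PT : P T = (-1) ^+ m * (F' T / w).
  by rewrite /P wth cos_natpi sin_natpi mulr0 add0r pT mulrC.
have Y0 : Y 0 = F 0 by rewrite /Y th0 mulr0 cos0 sin0 mulr0 subr0 mulr1.
have P0 : P 0 = F' 0 / w by rewrite /P th0 mulr0 cos0 sin0 mulr0 add0r mulr1.
rewrite eC; split.
  rewrite -YT -Y0; apply: HY => x x0 xT; rewrite mulNr normrN.
  by apply: (bd (@sin R)) => //; exact: sin_max.
rewrite -PT -P0; apply: HP => x x0 xT.
by apply: (bd (@cos R)) => //; exact: cos_max.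
Qed.

(** The trace is at least 1 at the even frequencies and at most -1 at the odd
    ones, and it is continuous in l. *)
Theorem trace_minus_one L : exists2 l, L < l & exists c c' s s' : R -> R,
  [/\ sol (potential Q k l) c c', sol (potential Q k l) s s',
      [/\ c 0 = 1, c' 0 = 0, s 0 = 0 & s' 0 = 1] & c T + s' T = -1].
Proof.
have Qc := smooth1_cont Qs.
have ex a b l : exists p : (R -> R) * (R -> R),
    [/\ sol (potential Q k l) p.1 p.2, p.1 0 = a & p.2 0 = b].
  have [F [F' [d d' e e']]] := sol_exists a b (@potential_cont _ Q k Qc l) (@potential_bound _ Q k q1 Q1 l).
  by exists (F, F'); split.
have [f Hf] := choice (ex 1 0); have [g Hg] := choice (ex 0 1).
pose D l := (f l).1 T + (g l).2 T.
have cD : continuous D.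
  have Ff l : sol (potential Q k l) (f l).1 (f l).2 by have [] := Hf l.
  have Gg l : sol (potential Q k l) (g l).1 (g l).2 by have [] := Hg l.
  have [cf _] := sol_param_cont Q1 T0 Ff (a := 1) (b := 0) (fun l => let: And3 _ h _ := Hf l in h)
    (fun l => let: And3 _ _ h := Hf l in h).
  have [_ cg] := sol_param_cont Q1 T0 Gg (a := 0) (b := 1) (fun l => let: And3 _ h _ := Hg l in h)
    (fun l => let: And3 _ _ h := Hg l in h).
  by move=> l; apply: cvgD; [exact: cf|exact: cg].
have [th th0 [C C0 H]] := monodromy_wkb.
have key w m : 1 <= w -> 2 * C <= w -> w * th = m%:R * pi ->
    1 <= (-1) ^+ m * D (w ^+ 2).
  move=> w1 wC wth; have w0 : 0 < w by lra.
  have Cw : C / w <= 2^-1 by rewrite ler_pdivrMr//; lra.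
  have [Sf f0 f'0] := Hf (w ^+ 2); have [Sg g0 g'0] := Hg (w ^+ 2).
  have [|h1 _] := H w m _ _ w1 wth Sf; first by rewrite f0 f'0 mul0r expr1n expr0n addr0.
  (* rescaled so that p(0) = 1 in the WKB coordinates *)
  have Sg2 := sol_lin w 0 Sg Sg.
  have [|_ h2] := H w m _ _ w1 wth Sg2.
    by rewrite /= g0 g'0 (_ : _ + _ = 1)//; field; exact: lt0r_neq0.
  rewrite /= !mul0r !addr0 g'0 mulr1 divff ?lt0r_neq0// in h2.
  rewrite f0 in h1.
  have e2 : w * (g (w ^+ 2)).2 T / w = (g (w ^+ 2)).2 T by rewrite mulrC mulKf// lt0r_neq0.
  rewrite e2 in h2.
  move: h1 h2; rewrite !ler_norml /D mulrDr => /andP[? _] /andP[? _]; lra.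
pose b := Num.max 1 (Num.max (2 * C) L).
have [b1 [b2 b3]] : 1 <= b /\ 2 * C <= b /\ L <= b by rewrite /b !le_max !lexx !orbT.
pose m := Num.bound (b * th / pi).
have pi0 := pi_gt0 R.
have Hm : b * th < m%:R * pi.
  by rewrite -ltr_pdivrMr//; apply: archi_boundP; rewrite divr_ge0 ?mulr_ge0//; lra.
(* n is odd: the trace is at most -1 at w1 and at least 1 at w2 *)
pose n := (m.*2).+1.
pose w1 := n%:R * pi / th; pose w2 := n.+1%:R * pi / th.
have bw1 : b < w1.
  rewrite /w1 ltr_pdivlMr//; apply: lt_le_trans Hm _; rewrite ler_pM2r// ler_nat /n.
  by rewrite -addnn; apply: leqW; exact: leq_addr.
have w12 : w1 < w2 by rewrite /w1 /w2 ltr_pM2r ?invr_gt0// ltr_pM2r// ltr_nat.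
have k1 := key w1 n _ _ _; have k2 := key w2 n.+1 _ _ _.
have thn : th != 0 by exact: lt0r_neq0.
have sn : (-1) ^+ n = -1 :> R by rewrite -signr_odd /n /= odd_double expr1.
have {}k1 : D (w1 ^+ 2) <= -1.
  have : 1 <= (-1) ^+ n * D (w1 ^+ 2) by apply: k1; [lra|lra|rewrite /w1 divfK].
  rewrite sn; lra.
have {}k2 : 1 <= D (w2 ^+ 2).
  have : 1 <= (-1) ^+ n.+1 * D (w2 ^+ 2) by apply: k2; [lra|lra|rewrite /w2 divfK].
  rewrite exprS sn; lra.
have ww : w1 ^+ 2 <= w2 ^+ 2 by rewrite ler_sqr ?nnegrE; lra.
have [|l lI Dl] := IVT (v := -1) ww (cont_within (A := _) cD).
  by rewrite le_max ge_min k1 /=; apply/orP; right; lra.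
exists l.
  have w1g : 1 < w1 by exact: le_lt_trans b1 bw1.
  have h1 : b < w1 ^+ 2.
    by rewrite expr2; apply: lt_trans bw1 _; rewrite ltr_pMr// (lt_trans ltr01).
  move: lI; rewrite in_itv/= => /andP[h _].
  exact: le_lt_trans b3 (lt_le_trans h1 h).
have [Sf f0 f'0] := Hf l; have [Sg g0 g'0] := Hg l.
by exists (f l).1, (f l).2, (g l).1, (g l).2; split.
Qed.

End Trace.

(** * Flat oscillating functions *)

Section FlatFunction.
Context {R : realType}.
Implicit Types (a b s t x C : R) (n : nat).

Definition trig a b t : R := a * sin t + b * cos t.

Lemma der_trig a b : der (trig a b) (trig (- b) a).
Proof.
apply: (der_eq (derD (derZ a (@der_sin R)) (derZ b (@der_cos R)))) => t.
by rewrite /trig /=; ring.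
Qed.

Lemma trig_bound a b t : `|trig a b t| <= `|a| + `|b|.
Proof.
apply: le_trans (ler_normD _ _) _; rewrite !normrM.
by rewrite lerD// ler_piMr// ?sin_max ?cos_max.
Qed.

Lemma derX n : der (fun t : R => t ^+ n) (fun t => n%:R * t ^+ n.-1).
Proof.
elim: n => [|n IH].
  by apply: (der_ext (der_cst 1)) => t; rewrite ?expr0 ?mul0r.
apply: (der_ext (derM (@der_id R) IH)) => t /=; first by rewrite exprS.
case: n IH => [|n] _; first by rewrite expr0; ring.
by rewrite -[n.+2%:R]natr1 exprS; ring.
Qed.

Lemma der_expN : der (fun t : R => expR (- t)) (fun t => - expR (- t)).
Proof.
by apply: (der_eq (der_comp (@der_exp R) (derN (@der_id R)))) => t; rewrite mulrN1.
Qed.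

(** The functions exp(-1/s) s^(-n) (a sin(1/s) + b cos(1/s)), extended by 0 to
    s <= 0. Their span is stable under derivation, which gives smoothness at
    once. *)
Definition flat n a b s : R :=
  if 0 < s then expR (- s^-1) * s^-1 ^+ n * trig a b s^-1 else 0.

Lemma flatE n a b s : 0 < s -> flat n a b s = expR (- s^-1) * s^-1 ^+ n * trig a b s^-1.
Proof. by rewrite /flat => ->. Qed.

Lemma exp_pow_bound n t : 0 < t -> expR (- t) * t ^+ n <= n`!%:R.
Proof.
move=> t0; case: n => [|n].
  by rewrite expr0 mulr1 -expR0 ler_expR oppr_le0 ltW.
have H := expR_ge1Dxn n (ltW t0); rewrite expRN mulrC ler_pdivrMr ?expR_gt0//.
have f0 : 0 < n.+1`!%:R :> R by rewrite ltr0n fact_gt0.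
rewrite mulrC -ler_pdivrMr//; lra.
Qed.

(** A quadratic bound is all that differentiability at 0 takes. *)
Lemma flat_bound0 n a b s :
  `|flat n a b s| <= (n.+2)`!%:R * (`|a| + `|b|) * (s * s).
Proof.
have ss : 0 <= s * s by rewrite -expr2 sqr_ge0.
rewrite /flat; case: ifP => [s0|_]; last by rewrite normr0 mulr_ge0// mulr_ge0 ?ler0n ?addr_ge0.
have i0 : 0 < s^-1 by rewrite invr_gt0.
rewrite normrM (ger0_norm (_ : 0 <= expR (- s^-1) * s^-1 ^+ n)); last first.
  by rewrite mulr_ge0 ?expR_ge0// exprn_ge0// ltW.
have -> : expR (- s^-1) * s^-1 ^+ n = expR (- s^-1) * s^-1 ^+ n.+2 * (s * s).
  by rewrite !exprSr; field; exact: lt0r_neq0.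
have h1 := exp_pow_bound n.+2 i0; have h2 := trig_bound a b s^-1.
rewrite [leRHS]mulrAC; apply: ler_pM => //.
  by rewrite mulr_ge0// mulr_ge0 ?expR_ge0// exprn_ge0// ltW.
by apply: ler_wpM2r.
Qed.

Lemma is_derive0_sq (f : R -> R) C : (forall s, `|f s| <= C * (s * s)) ->
  is_derive 0 (1 : R) f 0.
Proof.
move=> H.
have f0 : f 0 = 0.
  by apply/eqP; rewrite -normr_le0; have := H 0; rewrite mul0r mulr0.
apply/is_derive1_caratheodory; exists (fun z => f z / z); split.
- move=> z; rewrite f0 !subr0; have [->|z0] := eqVneq z 0; first by rewrite f0 mulr0.
  by rewrite divfK.
- apply/cvgrPdist_lt => e e0; rewrite invr0 mulr0.
  have C0 : 0 <= C by have := H 1; rewrite !mulr1; apply: le_trans.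
  have C1 : 0 < C + 1 by lra.
  near=> z; rewrite sub0r normrN normrM normfV.
  have hz : `|z| < e / (C + 1).
    near: z; apply/nbhs_ballP; exists (e / (C + 1)) => /=; first by rewrite divr_gt0.
    by move=> y; rewrite /ball/= sub0r normrN.
  have [->|z0] := eqVneq z 0; first by rewrite normr0 invr0 mulr0.
  have nz : 0 < `|z| by rewrite normr_gt0.
  rewrite ltr_pdivrMr//; apply: le_lt_trans (H z) _.
  have -> : C * (z * z) = C * `|z| * `|z|.
    by rewrite -mulrA -expr2 -expr2 real_normK ?num_real.
  rewrite ltr_pM2r//; rewrite ltr_pdivlMr// in hz.
  apply: le_lt_trans hz; rewrite mulrC ler_wpM2l//; lra.
- by rewrite f0 mul0r.
Unshelve. all: by end_near. Qed.

(** In the variable t = 1/s the functions are exp(-t) t^n times a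
    trigonometric polynomial, and d/ds = - t^2 d/dt. *)
Lemma der_flat n a b :
  der (flat n a b) (fun s => flat n.+2 (a + b) (b - a) s - n%:R * flat n.+1 a b s).
Proof.
move=> s; have [s0|s0|<-] := ltgtP 0 s.
- pose g t := expR (- t) * t ^+ n * trig a b t.
  have dg := derM (derM der_expN (derX n)) (der_trig a b).
  have dg' := dg s^-1; have sn : s != 0 by exact: lt0r_neq0.
  have di : is_derive s (1:R) (fun y : R => y^-1) (- s ^- 2).
    have := is_deriveV (f := id) sn (is_derive_id s 1).
    by rewrite /GRing.scale/= mulr1.
  have dc := is_derive1_comp dg' di.
  have -> : flat n.+2 (a + b) (b - a) s - n%:R * flat n.+1 a b s =
   (((- expR (- s^-1)) * s^-1 ^+ n + expR (- s^-1) * (n%:R * s^-1 ^+ n.-1)) * trig a b s^-1 +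
    expR (- s^-1) * s^-1 ^+ n * trig (- b) a s^-1) * (- s ^- 2).
    rewrite !flatE// /trig -exprVn; case: n {g dg dg' dc} => [|n]; first by ring.
    by rewrite /= !exprS; ring.
  apply: near_eq_is_derive dc.
  near=> y; rewrite /= flatE//; near: y; exact: lt_nbhsr.
- rewrite /flat ltNge (ltW s0)/= mulr0 subr0.
  apply: (near_eq_is_derive _ (is_derive_cst (0 : R) s 1)).
  near=> y; rewrite /cst ifF//; apply/negbTE; rewrite -leNgt ltW//.
  by near: y; exact: lt_nbhsl.
- rewrite [X in is_derive _ _ _ X](_ : _ = 0); last by rewrite /flat ltxx mulr0 subr0.
  apply: is_derive0_sq; exact: flat_bound0.
Unshelve. all: by end_near. Qed.

Lemma smooth1_flat n a b : smooth1 (flat n a b).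
Proof.
move=> k; elim: k n a b => // k IH n a b; eexists; first exact: der_flat.
by apply: kderD; [exact: IH|apply: kderN; apply: kderM; [exact: kder_cst|exact: IH]].
Qed.

End FlatFunction.

(** * The perturbation of the flat metric *)

Section Profile.
Context {R : realType}.
Implicit Types (x y t C : R).

(** One period of the sine is 1/3. *)
Definition freq : R := 6 * pi.

Lemma freq_ge12 : 12 <= freq.
Proof. by rewrite /freq; have := pi_ge2 R; lra. Qed.

Definition sin6pi x : R := sin (freq * x).
(** The function G: flat at 0, oscillating to the right of 0, zero just to the
    left of 0. *)
Definition profile x : R := flat 0 1 0 (sin6pi x).
Definition profile1 x : R := flat 2 1 (-1) (sin6pi x) * (freq * cos (freq * x)).
Definition profile2 x : R :=
  (flat 4 0 (-2) (sin6pi x) - 2 * flat 3 1 (-1) (sin6pi x)) * (freq * cos (freq * x)) ^+ 2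
  + flat 2 1 (-1) (sin6pi x) * - (freq ^+ 2 * sin6pi x).

Lemma der_freq : der (fun x => freq * x) (fun=> freq).
Proof. by apply: (der_eq (derZ freq (@der_id R))) => x; rewrite mulr1. Qed.

Lemma der_sin6pi : der sin6pi (fun x => freq * cos (freq * x)).
Proof. by apply: (der_eq (der_comp (@der_sin R) der_freq)) => x; rewrite mulrC. Qed.

Lemma der_profile : der profile profile1.
Proof.
apply: (der_eq (der_comp (der_flat 0 1 0) der_sin6pi)) => x.
by rewrite /profile1 mul0r subr0 addr0 sub0r.
Qed.

Lemma der_profile1 : der profile1 profile2.
Proof.
have dc := derZ freq (der_comp (@der_cos R) der_freq).
apply: (der_eq (derM (der_comp (der_flat 2 1 (-1)) der_sin6pi) dc)) => x.
rewrite /profile2 /sin6pi (_ : 1 + -1 = 0) ?subrr// (_ : -1 - 1 = -2) /=; last by ring.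
by ring.
Qed.

Lemma smooth1_profile : smooth1 profile.
Proof.
move=> k; apply: (kder_comp (@smooth1_flat R 0 1 0)).
apply: (kder_comp (f := @sin R)); first by move=> j; have [] := @kder_sincos R j.
by apply: kderM; [exact: kder_cst|exact: smooth1_id].
Qed.

Lemma smooth1_profile2 : smooth1 profile2.
Proof. exact: smooth1_derivative der_profile1 (smooth1_derivative der_profile smooth1_profile). Qed.

Lemma freq_third x : freq * (x + 3^-1) = freq * x + pi *+ 2.
Proof. by rewrite /freq mulrDr; congr (_ + _); field. Qed.

Lemma profile2_periodic x : profile2 (x + 3^-1) = profile2 x.
Proof. by rewrite /profile2 /sin6pi freq_third sinD2pi cosD2pi. Qed.

Lemma sin6pi0 : sin6pi 0 = 0. Proof. by rewrite /sin6pi mulr0 sin0. Qed.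

Lemma flat0 n (a b : R) : flat n a b 0 = 0. Proof. by rewrite /flat ltxx. Qed.

Lemma profile_at0 : [/\ profile 0 = 0, profile1 0 = 0 & profile2 0 = 0].
Proof. by rewrite /profile /profile1 /profile2 sin6pi0 !flat0; split; ring. Qed.

(** The quadratic factor is kept for the derivative at 0. *)
Lemma profile2_sq : exists2 B : R, 0 < B & forall x, `|profile2 x| <= B * (sin6pi x * sin6pi x).
Proof.
pose K1 : R := 6`!%:R * 2 + 2 * (5`!%:R * 2).
pose B : R := K1 * freq ^+ 2 + 4`!%:R * 2 * freq ^+ 2.
have nu0 : 0 < freq by have := freq_ge12; lra.
have fg n : 0 < n`!%:R :> R by rewrite ltr0n fact_gt0.
have n2 : 0 < freq ^+ 2 :> R by rewrite exprn_gt0.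
have K10 : 0 < K1 by rewrite /K1 addr_gt0// !mulr_gt0// ?fg.
exists B; first by apply: addr_gt0; apply: mulr_gt0 => //; apply: mulr_gt0.
move=> x.
have c1 : `|cos (freq * x)| <= 1 by exact: cos_max.
have F n (a b : R) : `|a| + `|b| = 2 ->
    `|flat n a b (sin6pi x)| <= (n.+2)`!%:R * 2 * (sin6pi x * sin6pi x).
  by move=> ab; apply: le_trans (flat_bound0 _ _ _ _) _; rewrite ab.
have n11 : `|1 : R| + `|-1 : R| = 2 by rewrite normrN normr1; ring.
have n02 : `|0 : R| + `|-2 : R| = 2 by rewrite normr0 normrN ger0_norm// add0r.
have F4 := F 4%N _ _ n02; have F3 := F 3%N _ _ n11; have F2 := F 2%N _ _ n11.
have -> : B * (sin6pi x * sin6pi x) = (6`!%:R * 2 * (sin6pi x * sin6pi x) + 2 * (5`!%:R * 2 * (sin6pi x * sin6pi x))) * freq ^+ 2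
   + 4`!%:R * 2 * (sin6pi x * sin6pi x) * freq ^+ 2 by rewrite /B /K1; ring.
rewrite /profile2; apply: le_trans (ler_normD _ _) _; apply: lerD.
  rewrite normrM; apply: ler_pM => //.
    apply: le_trans (ler_normB _ _) _; apply: lerD => //.
    by rewrite normrM ger0_norm// ler_wpM2l.
  have nn : 0 <= freq by exact: ltW.
  have h : `|freq * cos (freq * x)| <= freq by rewrite normrM ger0_norm// ler_piMr.
  by rewrite normrX ler_sqr ?nnegrE.
rewrite (normrM (flat _ _ _ _)) normrN; apply: ler_pM => //.
by rewrite (normrM (freq ^+ 2)) ger0_norm ?sqr_ge0// ler_piMr// ?sqr_ge0// sin_max.
Qed.

Lemma profile2_bound : exists2 B : R, 0 < B & forall x, `|profile2 x| <= B.
Proof.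
have [B B0 H] := profile2_sq; exists B => // x; apply: le_trans (H x) _.
rewrite ler_piMr// ?(ltW B0)// -expr2 -[_ ^+ 2]real_normK ?num_real//.
by rewrite expr_le1// sin_max.
Qed.

Lemma norm_sin6pi_le x : `|sin6pi x| <= freq * `|x|.
Proof.
wlog x0 : x / 0 <= x.
  move=> H; have [|/ltW x0] := leP 0 x; first exact: H.
  have := H (- x); rewrite oppr_ge0 /sin6pi mulrN sinN !normrN; exact.
rewrite (ger0_norm x0); have nx : 0 <= freq * x by rewrite mulr_ge0//; have := freq_ge12; lra.
have := der_bound (@der_sin R) nx (c := 1) _; rewrite sin0 !subr0 mul1r; apply.
by move=> t _ _; exact: cos_max.
Qed.

(** This is Q'(0) = 0, used for the WKB amplitude. *)
Lemma profile2_deriv0 (f' : R -> R) : der profile2 f' -> f' 0 = 0.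
Proof.
move=> df; have [B B0 H] := profile2_sq.
have D : is_derive 0 (1 : R) profile2 0.
  apply: (is_derive0_sq (C := B * (freq * freq))) => x; apply: le_trans (H x) _.
  rewrite -mulrA ler_pM2l//.
  have -> : freq * freq * (x * x) = (freq * `|x|) ^+ 2 by rewrite exprMn real_normK ?num_real//; ring.
  rewrite -expr2 -[leLHS]real_normK ?num_real// ler_sqr ?nnegrE ?norm_sin6pi_le//.
  by rewrite mulr_ge0//; have := freq_ge12; lra.
by have [_ <-] := df 0; have [_ ->] := D.
Qed.

(** The large variable 1/s, in terms of which the flat functions are
    exponentially small. *)
Definition tau x : R := (sin6pi x)^-1.
(** The scale exp(-tau) tau^a. A derivative costs a factor tau^2, while an
    integration from 0 gains the factor x <= 1/tau. *)
Definition flat_size a x : R := expR (- tau x) * tau x ^+ a.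

(** On ]0, d[ the variable s(x) is increasing and at least x, and tau >= 8
    makes the scales of order a <= 8 increasing in x. *)
Definition small_radius (d : R) := [/\ 0 < d, d <= 1 &
  forall x, 0 < x -> x < d ->
  [/\ x <= sin6pi x, 8 <= tau x, 2^-1 <= cos (freq * x) &
      forall t, 0 < t -> t <= x -> sin6pi t <= sin6pi x]].

Lemma small_radius_ex : exists d : R, small_radius d.
Proof.
pose d := (freq * 8)^-1.
have n12 := freq_ge12; have nu0 : 0 < freq by lra.
have d0 : 0 < d by rewrite invr_gt0 mulr_gt0.
have dnu : freq * d = 8^-1 by rewrite /d; field; exact: lt0r_neq0.
have cosb t : 0 <= t -> t < d -> 2^-1 <= cos (freq * t).
  move=> t0 td.
  have h : freq * t <= 8^-1 by rewrite -dnu ler_pM2l// ltW.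
  have h0 : 0 <= freq * t by rewrite mulr_ge0// ltW.
  have dc := der_bound (@der_cos R) h0 (c := 1) _.
  have := dc _; rewrite cos0 subr0 mul1r => K.
  have : `|cos (freq * t) - 1| <= freq * t by apply: K => z _ _; rewrite normrN sin_max.
  by rewrite ler_norml => /andP[]; lra.
exists d; split => //.
  have nu8 : 0 < freq * 8 by exact: mulr_gt0.
  by rewrite /d invf_le1//; lra.
move=> x x0 xd.
have sxx : x <= sin6pi x.
  have := der_le (@der_id R) der_sin6pi (ltW x0) _; rewrite sin6pi0 !subr0; apply => t t0 tx.
  have c := cosb t (ltW t0) (lt_trans tx xd).
  have : 12 * 2^-1 <= freq * cos (freq * t) by apply: ler_pM => //; lra.
  lra.
have sx8 : sin6pi x <= 8^-1.
  have h0 : 0 <= freq * x by rewrite mulr_ge0// ltW.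
  have := der_bound (@der_sin R) h0 (c := 1) _; rewrite sin0 !subr0 mul1r => K.
  have : `|sin (freq * x)| <= freq * x by apply: K => z _ _; rewrite cos_max.
  have h : freq * x <= 8^-1 by rewrite -dnu ler_pM2l// ltW.
  move=> K2; apply: le_trans (ler_norm _) (le_trans K2 h).
split => //.
- by rewrite /tau -[8]invrK lef_pV2// ?posrE ?invr_gt0//; lra.
- by apply: cosb => //; exact: ltW.
- move=> t t0 tx; apply: (der_mono der_sin6pi tx) => z tz zx.
  have c := cosb z (ltW (lt_trans t0 tz)) (lt_trans zx xd).
  by apply: mulr_ge0; lra.
Qed.

Section bounds.
Variables (d : R).
Hypothesis (Hd : small_radius d).

Lemma sin6pi_gt0 x : 0 < x -> x < d -> 0 < sin6pi x.
Proof. by move=> x0 xd; have [_ _ /(_ x x0 xd)[h _ _ _]] := Hd; lra. Qed.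

Lemma tau_ge8 x : 0 < x -> x < d -> 8 <= tau x.
Proof. by move=> x0 xd; have [_ _ /(_ x x0 xd)[]] := Hd. Qed.

Lemma flat_size_gt0 a x : 0 < x -> x < d -> 0 < flat_size a x.
Proof.
by move=> x0 xd; have h := tau_ge8 x0 xd; rewrite mulr_gt0 ?expR_gt0// exprn_gt0//; lra.
Qed.

(** The function t |-> exp(-t) t^a decreases for t >= a. *)
Lemma flat_size_mono a t x : (a <= 8)%N -> 0 < t -> t <= x -> x < d -> flat_size a t <= flat_size a x.
Proof.
move=> a8 t0 tx xd; have x0 := lt_le_trans t0 tx; have td := le_lt_trans tx xd.
have [_ _ /(_ x x0 xd)[_ _ _ /(_ t t0 tx) st]] := Hd.
have tt : tau x <= tau t by rewrite /tau lef_pV2 ?posrE ?sin6pi_gt0.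
have h8 := tau_ge8 x0 xd.
rewrite -lerN2 /flat_size.
apply: (der_mono (derN (derM der_expN (derX a))) tt) => z xz zt.
have z8 : 8 <= z by exact: le_trans h8 (ltW xz).
have z0 : 0 <= z by lra.
have -> : - (- expR (- z) * z ^+ a + expR (- z) * (a%:R * z ^+ a.-1)) =
  expR (- z) * (z ^+ a - a%:R * z ^+ a.-1) by ring.
rewrite mulr_ge0 ?expR_ge0// subr_ge0; case: a a8 => [|a] a8; first by rewrite mul0r expr0.
rewrite exprS ler_wpM2r ?exprn_ge0//=; apply: le_trans z8.
by rewrite (ler_nat R a.+1 8).
Qed.

Lemma flat_size_le a x : 0 < x -> x < d -> flat_size a x <= flat_size a.+1 x.
Proof.
move=> x0 xd; have h := tau_ge8 x0 xd; rewrite /flat_size exprS mulrCA.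
by rewrite -[leLHS]mul1r ler_wpM2r ?(ltW (flat_size_gt0 a x0 xd))//; lra.
Qed.

Lemma flat_size_x a x : 0 < x -> x < d -> flat_size a.+1 x * x <= flat_size a x.
Proof.
move=> x0 xd; have [_ _ /(_ x x0 xd)[h _ _ _]] := Hd; have s0 := sin6pi_gt0 x0 xd.
have -> : flat_size a.+1 x * x = flat_size a x * (x / sin6pi x) by rewrite /flat_size /tau exprS; ring.
have g0 := ltW (flat_size_gt0 a x0 xd).
by rewrite -[leRHS]mulr1 ler_wpM2l// ler_pdivrMr// mul1r.
Qed.

(** Since the scale is increasing, its integral over [0, x] is at most x times
    its value at x. *)
Lemma flat_size_int f f' a C : der f f' -> f 0 = 0 -> (a <= 8)%N -> 0 <= C ->
  (forall x, 0 < x -> x < d -> `|f' x| <= C * flat_size a x) ->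
  forall x, 0 < x -> x < d -> `|f x| <= C * (flat_size a x * x).
Proof.
move=> df f0 a8 C0 H x x0 xd.
have := der_bound df (ltW x0) (c := C * flat_size a x) _; rewrite f0 !subr0 mulrA; apply.
move=> t t0 tx; apply: le_trans (H t t0 (lt_trans tx xd)) _.
by rewrite ler_wpM2l// flat_size_mono// ltW.
Qed.

Lemma flat_le_size n (a b : R) x : 0 < x -> x < d ->
  `|flat n a b (sin6pi x)| <= (`|a| + `|b|) * flat_size n x.
Proof.
move=> x0 xd; rewrite flatE ?sin6pi_gt0// normrM mulrC.
rewrite [X in _ * X]ger0_norm ?(ltW (flat_size_gt0 n x0 xd))//.
by rewrite ler_wpM2r ?(ltW (flat_size_gt0 n x0 xd))// trig_bound.
Qed.

Let n0 : 0 <= freq. Proof. by have := freq_ge12; lra. Qed.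
Let norm11 : `|1 : R| + `|-1 : R| = 2. Proof. by rewrite normrN normr1; ring. Qed.
Let norm02 : `|0 : R| + `|-2 : R| = 2. Proof. by rewrite normr0 normrN ger0_norm// add0r. Qed.

Let nucos x : `|freq * cos (freq * x)| <= freq.
Proof. by rewrite normrM ger0_norm// ler_piMr// cos_max. Qed.

Lemma profile1_le x : 0 < x -> x < d -> `|profile1 x| <= 2 * freq * flat_size 2 x.
Proof.
move=> x0 xd; have := flat_le_size 2 1 (-1) x0 xd; rewrite norm11 => h.
rewrite /profile1 normrM; have -> : 2 * freq * flat_size 2 x = 2 * flat_size 2 x * freq by ring.
by apply: ler_pM.
Qed.

Lemma profile2_le x : 0 < x -> x < d -> `|profile2 x| <= 8 * freq ^+ 2 * flat_size 4 x.
Proof.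
move=> x0 xd.
have h2 := flat_le_size 2 1 (-1) x0 xd; rewrite norm11 in h2.
have h3 := flat_le_size 3 1 (-1) x0 xd; rewrite norm11 in h3.
have h4 := flat_le_size 4 0 (-2) x0 xd; rewrite norm02 in h4.
have l2 := flat_size_le 2 x0 xd; have l3 := flat_size_le 3 x0 xd.
have nn : 0 <= freq ^+ 2 by exact: sqr_ge0.
rewrite /profile2; apply: le_trans (ler_normD _ _) _.
have k1 : `|(flat 4 0 (-2) (sin6pi x) - 2 * flat 3 1 (-1) (sin6pi x)) * (freq * cos (freq * x)) ^+ 2|
   <= 6 * flat_size 4 x * freq ^+ 2.
  rewrite normrM; apply: ler_pM => //.
    apply: le_trans (ler_normB _ _) _; rewrite normrM (ger0_norm (_ : 0 <= 2))//; lra.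
  by rewrite normrX ler_sqr ?nnegrE.
have k2 : `|flat 2 1 (-1) (sin6pi x) * - (freq ^+ 2 * sin6pi x)| <= 2 * flat_size 4 x * freq ^+ 2.
  rewrite normrM normrN; apply: ler_pM => //; first lra.
  by rewrite normrM ger0_norm// ler_piMr// sin_max.
lra.
Qed.

End bounds.
End Profile.

(** * The amplitude near the flat point *)

Section LocalAnalysis.
Context {R : realType}.
Variables (mu V0 : R) (r S Z : R -> R).
Hypotheses (mu0 : 0 < mu) (V00 : 0 < V0).

(** Here r = R - 1 and S = R'/2 for the squared amplitude R of a plane wave,
    and Z collects what is left of S' after the two leading terms. The
    unknowns (r, S, Z) solve a linear system forced only by mu G''. *)
Definition S_deriv x := - (mu * (profile2 x * (1 + r x))) - 2 * V0 * r x + Z x.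

Hypotheses (dr : der r (fun x => 2 * S x)) (dS : der S S_deriv)
  (dZ : der Z (fun x => - (2 * mu * (profile2 x * S x)))).
Hypotheses (r0 : r 0 = 0) (S0 : S 0 = 0) (Z0 : Z 0 = 0).

Variable (d : R).
Hypothesis (Hd : small_radius d).

Let dD1 : der (fun x => S x + mu * profile1 x)
  (fun x => - (mu * (profile2 x * r x)) - 2 * V0 * r x + Z x).
Proof. by apply: (der_eq (derD dS (derZ mu (@der_profile1 R)))) => x; rewrite /S_deriv; ring. Qed.

Let D10 : S 0 + mu * profile1 0 = 0.
Proof. by have [_ -> _] := @profile_at0 R; rewrite S0 mulr0 addr0. Qed.

Let dD2 : der (fun x => r x + 2 * mu * profile x) (fun x => 2 * (S x + mu * profile1 x)).
Proof. by apply: (der_eq (derD dr (derZ (2 * mu) (@der_profile R)))) => x; ring. Qed.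

Let D20 : r 0 + 2 * mu * profile 0 = 0.
Proof. by have [-> _ _] := @profile_at0 R; rewrite r0 mulr0 addr0. Qed.

(** Domination by a multiple of g on the one-sided neighbourhood ]0, d[ of
    0. *)
Definition dominated (f : R -> R) (g : R -> R) := exists2 C : R, 0 <= C &
  forall x, 0 < x -> x < d -> `|f x| <= C * g x.

Let bd_D1' a : dominated r (flat_size a) -> dominated Z (flat_size a) ->
  dominated (fun x => - (mu * (profile2 x * r x)) - 2 * V0 * r x + Z x) (flat_size a).
Proof.
move=> [C C0 Hr] [C' C'0 HZ]; have [B B0 HB] := @profile2_bound R.
exists ((mu * B + 2 * V0) * C + C').
  by rewrite addr_ge0// mulr_ge0// addr_ge0 ?mulr_ge0 ?ltW.
move=> x x0 xd; have h1 := Hr x x0 xd; have h2 := HZ x x0 xd.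
apply: le_trans (ler_normD _ _) _; rewrite [leRHS]mulrDl; apply: lerD => //.
have -> : - (mu * (profile2 x * r x)) - 2 * V0 * r x = - ((mu * profile2 x + 2 * V0) * r x) by ring.
rewrite normrN (normrM _ (r x)) -mulrA; apply: ler_pM => //.
apply: le_trans (ler_normD _ _) _; rewrite (normrM mu) (ger0_norm (ltW mu0)).
have v2 : 0 <= 2 * V0 by have h := V00; lra.
by rewrite (ger0_norm v2) lerD2r ler_pM2l.
Qed.

Let bd_int f f' a : der f f' -> f 0 = 0 -> (a < 8)%N -> dominated f' (flat_size a.+1) -> dominated f (flat_size a).
Proof.
move=> df f0 a8 [C C0 H]; exists C => // x x0 xd.
apply: le_trans (flat_size_int Hd df f0 a8 C0 H x0 xd) _.
by rewrite ler_wpM2l//; exact: (flat_size_x Hd a x0 xd).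
Qed.

Let bd_weak f a : dominated f (flat_size a) -> dominated f (flat_size a.+1).
Proof.
move=> [C C0 H]; exists C => // x x0 xd; apply: le_trans (H x x0 xd) _.
by rewrite ler_wpM2l//; exact: (flat_size_le Hd a x0 xd).
Qed.

Let bd_ext f g h : f =1 g -> dominated f h -> dominated g h.
Proof. by move=> /funext ->. Qed.

Let bd_add f g a : dominated f (flat_size a) -> dominated g (flat_size a) -> dominated (fun x => f x + g x) (flat_size a).
Proof.
move=> [C C0 H] [C' C'0 H']; exists (C + C'); first exact: addr_ge0.
move=> x x0 xd; apply: le_trans (ler_normD _ _) _.
by rewrite mulrDl lerD ?H ?H'.
Qed.

Let bd_scale c f a : dominated f (flat_size a) -> dominated (fun x => c * f x) (flat_size a).
Proof.
move=> [C C0 H]; exists (`|c| * C); first exact: mulr_ge0.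
by move=> x x0 xd; rewrite normrM -mulrA ler_wpM2l// H.
Qed.

Let bd_S a : dominated (fun x => S x + mu * profile1 x) (flat_size a) -> (2 <= a)%N -> dominated S (flat_size a).
Proof.
move=> H a2; have P2 : dominated profile1 (flat_size 2).
  exists (2 * freq); first by rewrite mulr_ge0//; have := @freq_ge12 R; lra.
  by move=> x x0 xd; exact: (profile1_le Hd x0 xd).
have Pa : dominated profile1 (flat_size a).
  by rewrite -(subnK a2); elim: (a - 2)%N => // n IH; rewrite addSn; exact: bd_weak.
by apply: bd_ext (bd_add H (bd_scale (- mu) Pa)) => x; ring.
Qed.

Let bd_Z' a : dominated S (flat_size a) -> dominated (fun x => - (2 * mu * (profile2 x * S x))) (flat_size a).
Proof.
move=> [C C0 H]; have [B B0 HB] := @profile2_bound R.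
exists (2 * mu * B * C); first by rewrite !mulr_ge0// ltW.
move=> x x0 xd; rewrite normrN.
have -> : 2 * mu * (profile2 x * S x) = (2 * mu * profile2 x) * S x by ring.
rewrite (normrM _ (S x)) -[leRHS]mulrA; apply: ler_pM => //; last exact: H.
have m2 : 0 < 2 * mu by have h := mu0; lra.
by rewrite (normrM (2 * mu)) (ger0_norm (ltW m2)) ler_pM2l.
Qed.

(** Gronwall for r^2 + S^2 + Z^2, with the forcing bounded by its value at the
    end point, which is legitimate because the scale is increasing. *)
Let rough : dominated r (flat_size 4) /\ dominated S (flat_size 4) /\ dominated Z (flat_size 4).
Proof.
have [B B0 HB] := @profile2_bound R.
pose N x := r x * r x + S x * S x + Z x * Z x.
have dN : der N (fun x => 4 * (r x * S x) + 2 * (S x * S_deriv x) - 4 * mu * (profile2 x * (S x * Z x))).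
  by apply: (der_eq (derD (derD (derM dr dr) (derM dS dS)) (derM dZ dZ))) => x; ring.
have N0 : N 0 = 0 by rewrite /N r0 S0 Z0 !mul0r !addr0.
pose K := 4 + 3 * (mu * B) + 2 * V0.
have mB : 0 < mu * B by exact: mulr_gt0.
have K0 : 0 <= K by rewrite /K; have h := V00; lra.
pose C := mu * (8 * freq ^+ 2) * (1 + expR K).
have nn : 0 <= freq ^+ 2 :> R by exact: sqr_ge0.
have eK := expR_gt0 K.
have eK1 : 0 <= 1 + expR K by lra.
have mn : 0 <= mu * (8 * freq ^+ 2) by rewrite mulr_ge0 ?(ltW mu0)// mulr_ge0.
have C0 : 0 <= C by rewrite mulr_ge0.
have [_ d1 _] := Hd.
suff NC x : 0 < x -> x < d -> N x <= (C * flat_size 4 x) ^+ 2.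
  have sq (u : R) x : 0 < x -> x < d -> u ^+ 2 <= N x -> `|u| <= C * flat_size 4 x.
    move=> x0 xd h; rewrite -ler_sqr ?nnegrE//; last by rewrite mulr_ge0// (ltW (flat_size_gt0 Hd 4 x0 xd)).
    by rewrite real_normK ?num_real//; exact: le_trans h (NC x x0 xd).
  split; [|split]; exists C => // x x0 xd; apply: sq => //; rewrite /N;
    have := sqr_ge0 (r x); have := sqr_ge0 (S x); have := sqr_ge0 (Z x); lra.
move=> x0 xd.
pose Y := mu * (8 * freq ^+ 2) * flat_size 4 x.
have g0 := flat_size_gt0 Hd 4 x0 xd.
have Y0 : 0 <= Y by rewrite mulr_ge0// ltW.
have Y20 : 0 <= Y ^+ 2 by exact: sqr_ge0.
have := gronwall dN (ltW x0) K0 Y20 _; rewrite N0 add0r subr0 => H.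
apply: le_trans (H _) _.
  move=> t t0 tx; have td := lt_trans tx xd.
  have pY : `|mu * profile2 t| <= Y.
    rewrite (normrM mu) (ger0_norm (ltW mu0)) /Y -mulrA ler_wpM2l ?(ltW mu0)//.
    apply: le_trans (profile2_le Hd t0 td) _.
    by apply: ler_wpM2l; [rewrite mulr_ge0|apply: (flat_size_mono Hd) => //; exact: ltW].
  have pB : `|mu * profile2 t| <= mu * B.
    by rewrite (normrM mu) (ger0_norm (ltW mu0)) ler_wpM2l ?HB ?ltW.
  set q := mu * profile2 t in pY pB.
  have q2 : q ^+ 2 <= Y ^+ 2 by rewrite -[q ^+ 2]real_normK ?num_real// ler_sqr ?nnegrE.
  have -> : 4 * (r t * S t) + 2 * (S t * S_deriv t) - 4 * mu * (profile2 t * (S t * Z t)) =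
     4 * (r t * S t) - 2 * (S t * q) - q * (2 * (r t * S t)) - 2 * V0 * (2 * (r t * S t))
     + 2 * (S t * Z t) - 2 * q * (2 * (S t * Z t)) by rewrite /S_deriv /q; ring.
  have ag (u v : R) : `|2 * (u * v)| <= u ^+ 2 + v ^+ 2.
    have := sqr_ge0 (u - v); have := sqr_ge0 (u + v); rewrite ler_norml => ? ?.
    by apply/andP; split; lra.
  have a1 := ag (r t) (S t); have a2 := ag (S t) (Z t); have a3 := ag (S t) q.
  have b1 : `|q * (2 * (r t * S t))| <= mu * B * (r t ^+ 2 + S t ^+ 2) by rewrite normrM ler_pM.
  have b2 : `|q * (2 * (S t * Z t))| <= mu * B * (S t ^+ 2 + Z t ^+ 2) by rewrite normrM ler_pM.
  have b3 : `|V0 * (2 * (r t * S t))| <= V0 * (r t ^+ 2 + S t ^+ 2).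
    by rewrite normrM (ger0_norm (ltW V00)) ler_wpM2l// ltW.
  have p1 : 0 <= mu * B * r t ^+ 2 by rewrite mulr_ge0 ?sqr_ge0// ltW.
  have p2 : 0 <= mu * B * S t ^+ 2 by rewrite mulr_ge0 ?sqr_ge0// ltW.
  have p3 : 0 <= mu * B * Z t ^+ 2 by rewrite mulr_ge0 ?sqr_ge0// ltW.
  have p4 : 0 <= V0 * Z t ^+ 2 by rewrite mulr_ge0 ?sqr_ge0// ltW.
  have s1 := sqr_ge0 (r t); have s2 := sqr_ge0 (S t); have s3 := sqr_ge0 (Z t).
  move: a1 a2 a3 b1 b2 b3; rewrite !ler_norml => /andP[? ?] /andP[? ?] /andP[? ?].
  move=> /andP[? ?] /andP[? ?] /andP[? ?].
  rewrite /K /N; lra.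
have x1 : x <= 1 by exact: le_trans (ltW xd) d1.
have e1 : expR (K * x) <= expR K by rewrite ler_expR -[leRHS]mulr1 ler_wpM2l.
have -> : (C * flat_size 4 x) ^+ 2 = Y ^+ 2 * (1 + expR K) ^+ 2 by rewrite /C /Y; ring.
rewrite -mulrA; apply: ler_wpM2l => //.
apply: (@le_trans _ _ (1 * expR K)); first by apply: ler_pM => //; rewrite ?ltW// expR_gt0.
have := sqr_ge0 (expR K); lra.
Qed.

(** Bootstrap from the rough bound. The corrections D1 = S + mu G' and D2 = r
    + 2 mu G satisfy D2' = 2 D1, and D1' is a combination of r and Z with
    bounded coefficients, without the forcing. Each turn integrates r, S, Z
    and D1 once more and gains powers of 1/tau, until D1 is much smaller than
    G' and D2 much smaller than G. *)
Lemma local_asymptotics : exists2 C : R, 0 < C & forall x, 0 < x -> x < d ->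
  [/\ `|r x + 2 * mu * profile x| <= C * (flat_size 0 x * x),
      `|S x + mu * profile1 x| <= C * flat_size 0 x &
      `|S_deriv x + mu * profile2 x| <= C * flat_size 1 x].
Proof.
have [r4 [S4 Z4]] := rough.
have D3 := bd_int dD1 D10 (isT : (3 < 8)%N) (bd_D1' r4 Z4).
have S3 := bd_S D3 isT.
have r2 := bd_int dr r0 (isT : (2 < 8)%N) (bd_scale 2 S3).
have Z2 := bd_int dZ Z0 (isT : (2 < 8)%N) (bd_Z' S3).
have D1 := bd_int dD1 D10 (isT : (1 < 8)%N) (bd_D1' r2 Z2).
have S2 := bd_S (bd_weak D1) isT.
have r1 := bd_int dr r0 (isT : (1 < 8)%N) (bd_scale 2 S2).
have Z1 := bd_int dZ Z0 (isT : (1 < 8)%N) (bd_Z' S2).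
have E1 := bd_D1' r1 Z1.
have D0 := bd_int dD1 D10 (isT : (0 < 8)%N) E1.
have [C1 C10 H1] := E1; have [C2 C20 H2] := D0.
have [C3 C30 H3] := bd_scale 2 D0.
exists (C1 + C2 + C3 + 1); first lra.
move=> x x0 xd.
have h3 := flat_size_int Hd dD2 D20 (isT : (0 <= 8)%N) C30 H3 x0 xd.
have g0 := flat_size_gt0 Hd 0 x0 xd; have g1 := flat_size_gt0 Hd 1 x0 xd.
have g0x : 0 <= flat_size 0 x * x by rewrite mulr_ge0// ltW.
split.
- by apply: le_trans h3 _; apply: ler_wpM2r => //; lra.
- by apply: le_trans (H2 x x0 xd) _; apply: ler_wpM2r => //; lra.
- have -> : S_deriv x + mu * profile2 x = - (mu * (profile2 x * r x)) - 2 * V0 * r x + Z x by rewrite /S_deriv; ring.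
  by apply: le_trans (H1 x x0 xd) _; apply: ler_wpM2r => //; lra.
Qed.

End LocalAnalysis.

(** * Oscillation of the amplitude *)

Section Oscillation.
Context {R : realType}.
Variables (mu C d : R) (r S S1 : R -> R).
Hypotheses (mu0 : 0 < mu) (C0 : 0 < C) (Hd : small_radius d).
Hypotheses (dr : der r (fun x => 2 * S x)).
Hypothesis HC : forall x, 0 < x -> x < d ->
  [/\ `|r x + 2 * mu * profile x| <= C * (flat_size 0 x * x),
      `|S x + mu * profile1 x| <= C * flat_size 0 x &
      `|S1 x + mu * profile2 x| <= C * flat_size 1 x].

Let nu0 : 0 < freq :> R. Proof. by have := @freq_ge12 R; lra. Qed.

Lemma sin6pi_le x : 0 <= x -> @sin6pi R x <= freq * x.
Proof.
move=> x0; have := der_le (@der_sin6pi R) (derZ freq (@der_id R)) x0 _.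
rewrite sin6pi0 mulr0 !subr0; apply => t _ _.
by rewrite mulr1 ler_piMr ?cos_le1// ltW.
Qed.

(** Intermediate values of the sine between 0 and a point close to 0. *)
Lemma tau_onto e : 0 < e -> exists2 M : R, 0 < M &
  forall t, M < t -> exists x, [/\ 0 < x, x < e, x < d & tau x = t].
Proof.
move=> e0; have [d0 d1 _] := Hd.
pose x1 := Num.min e d / 2.
have m0 : 0 < Num.min e d by rewrite lt_min e0.
have x10 : 0 < x1 by rewrite divr_gt0.
have x1m : x1 < Num.min e d by rewrite /x1; lra.
have [x1e x1d] : x1 < e /\ x1 < d by move: x1m; rewrite lt_min => /andP.
have s1 := sin6pi_gt0 Hd x10 x1d.
exists (sin6pi x1)^-1; first by rewrite invr_gt0.
move=> t Mt; have t0 : 0 < t by apply: lt_trans Mt; rewrite invr_gt0.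
have ts : t^-1 < sin6pi x1 by rewrite -[ltRHS]invrK ltf_pV2 ?posrE ?invr_gt0.
have ti : 0 < t^-1 by rewrite invr_gt0.
have [|x] := IVT (v := t^-1) (ltW x10) (cont_within (A := _) (der_cont (@der_sin6pi R))).
  by rewrite sin6pi0 ge_min le_max (ltW ti) (ltW ts) orbT.
rewrite in_itv/= => /andP[x0 xx1] sxE; exists x.
have {}x0 : 0 < x.
  rewrite lt_neqAle x0 andbT; apply/eqP => xE.
  by move: sxE ti; rewrite -xE sin6pi0 => <-; rewrite ltxx.
split => //; [exact: le_lt_trans x1e|exact: le_lt_trans x1d|].
by rewrite /tau sxE invrK.
Qed.

Lemma profile_tau x : 0 < x -> x < d -> profile x = flat_size 0 x * sin (tau x).
Proof.
move=> x0 xd; rewrite /profile flatE ?(sin6pi_gt0 Hd)// /flat_size /trig /tau.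
by rewrite mul1r mul0r addr0.
Qed.

(** At the points where sin(tau) = 1 or -1 the term 2 mu G dominates the
    error. *)
Lemma sign_points e : 0 < e ->
  (exists x, [/\ 0 < x, x < e & r x < 0]) /\ (exists x, [/\ 0 < x, x < e & 0 < r x]).
Proof.
move=> e0.
pose e1 := Num.min e (mu / C).
have e10 : 0 < e1 by rewrite lt_min e0 divr_gt0.
have [M M0 HM] := tau_onto e10.
have key (a : R) : exists x, [/\ 0 < x, x < e, x < d, x < mu / C & sin (tau x) = sin a].
  have p2 : 0 < pi *+ 2 :> R by rewrite mulrn_wgt0// pi_gt0.
  have := archi_boundP (divr_ge0 (addr_ge0 (ltW M0) (normr_ge0 a)) (ltW p2)).
  set n := Num.bound _; rewrite ltr_pdivrMr// => Hn.
  have [|x [x0 xe xd tx]] := HM (a + (pi *+ 2) *+ n).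
    have := ler_norm (- a); rewrite normrN -[(pi *+ 2) *+ n]mulr_natl; lra.
  move: xe; rewrite lt_min => /andP[xe xm]; exists x; split => //.
  by rewrite tx (periodicn (@sinD2pi R)).
have bnd x : 0 < x -> x < d -> x < mu / C -> C * (flat_size 0 x * x) < mu * flat_size 0 x.
  move=> x0 xd; rewrite ltr_pdivlMr// => h.
  have -> : C * (flat_size 0 x * x) = x * C * flat_size 0 x by ring.
  by rewrite ltr_pM2r// (flat_size_gt0 Hd).
split.
  have [x [x0 xe xd xm sE]] := key (pi / 2).
  exists x; split => //.
  have [h _ _] := HC x0 xd; have b := bnd x x0 xd xm.
  have g := flat_size_gt0 Hd 0 x0 xd; have mg := mulr_gt0 mu0 g.
  move: h; rewrite profile_tau// sE sin_pihalf mulr1 ler_norml => /andP[_ h]; lra.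
have [x [x0 xe xd xm sE]] := key (- (pi / 2)).
exists x; split => //.
have [h _ _] := HC x0 xd; have b := bnd x x0 xd xm.
have g := flat_size_gt0 Hd 0 x0 xd; have mg := mulr_gt0 mu0 g.
move: h; rewrite profile_tau// sE sinN sin_pihalf mulrN1 ler_norml => /andP[h _]; lra.
Qed.

(** If S = 0 then G' is small, so sin(tau) and cos(tau) are nearly equal and
    cos(tau) is at least 1/2 in absolute value. Then the term 2 tau^4 cos(tau)
    of G'' dominates the error in S' = - mu G'' + O(exp(-tau) tau). *)
Lemma nondegenerate : exists2 e : R, 0 < e & forall x, 0 < x -> x < e -> S x = 0 -> S1 x != 0.
Proof.
(* tau > M contradicts the final inequality and gives |sin tau - cos tau| <= 1/4 *)
pose M := C / mu * (1 + 3 * freq ^+ 2) + 4 * (C / mu) + 1.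
have n2 : 0 <= freq ^+ 2 :> R by exact: sqr_ge0.
have Cm : 0 < C / mu by rewrite divr_gt0.
have Cn : 0 <= C / mu * (1 + 3 * freq ^+ 2) by rewrite mulr_ge0 ?(ltW Cm)// addr_ge0// mulr_ge0.
have M0 : 0 < M by rewrite /M; lra.
have [d0 d1 _] := Hd.
exists (Num.min d (freq * M)^-1); first by rewrite lt_min d0 invr_gt0 mulr_gt0.
move=> x x0; rewrite lt_min => /andP[xd xM] Sx; apply/eqP => S1x.
have s0 := sin6pi_gt0 Hd x0 xd.
have t8 := tau_ge8 Hd x0 xd.
have tM : M < tau x.
  rewrite /tau -[M]invrK ltf_pV2 ?posrE ?invr_gt0//.
  apply: le_lt_trans (sin6pi_le (ltW x0)) _.
  by move: xM; rewrite invfM mulrC ltr_pdivlMr// mulrC.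
have g := flat_size_gt0 Hd 0 x0 xd.
have [_ _ /(_ x x0 xd)[_ _ cx _]] := Hd.
have c1 := cos_le1 (freq * x).
have [_ h1 h2] := HC x0 xd.
set t := tau x in t8 tM.
have st : sin6pi x = t^-1 by rewrite /t /tau invrK.
have tn : t != 0 by rewrite lt0r_neq0//; lra.
pose e := sin t - cos t.
pose c := freq * cos (freq * x).
have c6 : 6 <= c.
  have : 12 * 2^-1 <= c by apply: ler_pM => //; have := @freq_ge12 R; lra.
  lra.
have cn : c <= freq by rewrite /c ler_piMr// ltW.
have P1 : profile1 x = flat_size 0 x * (t ^+ 2 * e * c).
  by rewrite /profile1 flatE// /trig /flat_size /e /c -/(tau x) -/t; ring.
have P2 : profile2 x = flat_size 0 x * ((- (2 * t ^+ 4 * cos t) - 2 * t ^+ 3 * e) * c ^+ 2 - t * e * freq ^+ 2).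
  rewrite /profile2 !flatE// /trig /flat_size /e /c -/(tau x) -/t st.
  by field.
have G1 : flat_size 1 x = flat_size 0 x * t by rewrite /flat_size expr0 expr1 mulr1.
have t1 : 1 <= t by lra.
have K1 : t ^+ 2 * `|e| <= C / mu.
  have : flat_size 0 x * (mu * (t ^+ 2 * `|e| * c)) <= flat_size 0 x * C.
    move: h1; rewrite Sx add0r P1 normrM (ger0_norm (ltW mu0)) normrM (ger0_norm (ltW g)).
    rewrite (normrM _ c) (normrM _ e) (ger0_norm (sqr_ge0 t)) (ger0_norm (_ : 0 <= c)); last lra.
    lra.
  rewrite ler_pM2l// => k; rewrite ler_pdivlMr//.
  apply: le_trans k; rewrite mulrC ler_pM2l//.
  by rewrite ler_peMr ?mulr_ge0 ?sqr_ge0//; lra.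
have e4 : `|e| <= 4^-1.
  have : t * `|e| <= C / mu.
    by apply: le_trans K1; rewrite expr2 -mulrA ler_peMl// mulr_ge0//; lra.
  move=> k; have tC : 4 * (C / mu) <= t by have := ltW tM; rewrite /M; lra.
  have : t * `|e| <= t * 4^-1 by lra.
  by rewrite ler_pM2l//; lra.
have cos2 : 2^-1 <= `|cos t|.
  rewrite leNgt; apply/negP => ch.
  have sE : sin t = cos t + e by rewrite /e; ring.
  have := cos2Dsin2 t; rewrite sE => h.
  have k1 : cos t ^+ 2 <= 4^-1.
    rewrite -[cos t ^+ 2]real_normK ?num_real//.
    have -> : 4^-1 = 2^-1 ^+ 2 :> R by field.
    by rewrite ler_sqr ?nnegrE ?invr_ge0//; exact: ltW.
  have k2 : e ^+ 2 <= 16^-1.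
    rewrite -[e ^+ 2]real_normK ?num_real//.
    have -> : 16^-1 = 4^-1 ^+ 2 :> R by field.
    by rewrite ler_sqr ?nnegrE ?invr_ge0.
  have := sqr_ge0 (cos t - e); lra.
have cc : 36 <= c ^+ 2.
  have -> : 36 = 6 ^+ 2 :> R by ring.
  by rewrite ler_sqr ?nnegrE//; lra.
have cn2 : c ^+ 2 <= freq ^+ 2 by rewrite ler_sqr ?nnegrE ?(ltW nu0)//; lra.
(* the dominant term of profile2 beats the error *)
pose A := 2 * t ^+ 4 * cos t * c ^+ 2; pose Br := 2 * t ^+ 3 * e * c ^+ 2 + t * e * freq ^+ 2.
have h3 : mu * `|A + Br| <= C * t.
  have : flat_size 0 x * (mu * `|A + Br|) <= flat_size 0 x * (C * t).
    move: h2; rewrite S1x add0r P2 G1 normrM (ger0_norm (ltW mu0)) normrM (ger0_norm (ltW g)).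
    have -> : (- (2 * t ^+ 4 * cos t) - 2 * t ^+ 3 * e) * c ^+ 2 - t * e * freq ^+ 2 = - (A + Br).
      by rewrite /A /Br; ring.
    by rewrite normrN; lra.
  by rewrite ler_pM2l.
have t3 : 0 <= t ^+ 3 by rewrite exprn_ge0//; lra.
have t4 : 0 <= t ^+ 4 by rewrite exprn_ge0//; lra.
have hA : t ^+ 4 <= `|A|.
  rewrite /A (normrM _ (c ^+ 2)) (normrM _ (cos t)).
  rewrite (ger0_norm (sqr_ge0 c)) (ger0_norm (_ : 0 <= 2 * t ^+ 4)); last by rewrite mulr_ge0.
  have : 2 * t ^+ 4 * 2^-1 <= 2 * t ^+ 4 * `|cos t| by apply: ler_wpM2l => //; rewrite mulr_ge0.
  move=> k; have : 2 * t ^+ 4 * 2^-1 * 36 <= 2 * t ^+ 4 * `|cos t| * c ^+ 2.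
    by apply: ler_pM => //; lra.
  lra.
have hB : `|Br| <= C / mu * (3 * freq ^+ 2) * t.
  have te : t * (t ^+ 2 * `|e|) <= t * (C / mu) by rewrite ler_pM2l//; lra.
  have en := normr_ge0 e.
  apply: le_trans (ler_normD _ _) _.
  have b1 : `|2 * t ^+ 3 * e * c ^+ 2| <= 2 * (t * (C / mu)) * freq ^+ 2.
    rewrite (normrM _ (c ^+ 2)) (normrM _ e) (ger0_norm (sqr_ge0 c)).
    rewrite (ger0_norm (_ : 0 <= 2 * t ^+ 3)); last by rewrite mulr_ge0.
    have -> : 2 * t ^+ 3 * `|e| = 2 * (t * (t ^+ 2 * `|e|)) by ring.
    have q0 : 0 <= t * (t ^+ 2 * `|e|) by apply: mulr_ge0; [lra|rewrite mulr_ge0// sqr_ge0].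
    by apply: ler_pM => //; [lra|exact: sqr_ge0|lra].
  have b2 : `|t * e * freq ^+ 2| <= t * (C / mu) * freq ^+ 2.
    rewrite (normrM _ (freq ^+ 2)) (normrM _ e) (ger0_norm n2) (ger0_norm (_ : 0 <= t)); last lra.
    apply: ler_wpM2r => //; apply: le_trans te; rewrite ler_pM2l; last lra.
    by rewrite ler_peMl// exprn_ege1.
  lra.
have h4 : `|A + Br| <= C / mu * t.
  by rewrite -(ler_pM2l mu0); apply: le_trans h3 _; rewrite mulrA mulrCA divff ?mulr1 ?lt0r_neq0.
have h5 : t ^+ 4 <= C / mu * (1 + 3 * freq ^+ 2) * t.
  have := ler_normB (A + Br) Br; rewrite addrK; lra.
have h6 : C / mu * (1 + 3 * freq ^+ 2) * t < t * t.
  by rewrite ltr_pM2r; [apply: le_lt_trans tM; rewrite /M; lra|lra].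
have : t * t <= t ^+ 4.
  have -> : t ^+ 4 = t * t * t ^+ 2 by ring.
  by rewrite ler_peMr ?exprn_ege1// mulr_ge0//; lra.
lra.
Qed.

(** Between two points with r < 0 that enclose a point with r > 0, the maximum
    of r is interior. *)
Lemma bumps e : 0 < e -> exists p : R * R * R,
  [/\ [/\ 0 < p.1.1, p.1.1 < p.1.2, p.1.2 < p.2 & p.2 < e],
     r p.1.1 < 0, r p.2 < 0, 0 < r p.1.2 & S p.1.2 = 0].
Proof.
move=> e0.
have [[z2 [z20 z2e rz2]] _] := sign_points e0.
have [_ [a [a0 az2 ra]]] := sign_points z20.
have [[z1 [z10 z1a rz1]] _] := sign_points a0.
have z12 : z1 <= z2 by rewrite ltW// (lt_trans z1a).
have cr := der_cont dr.
have [x xI xmax] := EVT_max z12 (cont_within (A := _) cr).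
have rx : 0 < r x.
  by apply: lt_le_trans ra (xmax a _); rewrite in_itv/= !ltW.
move: xI; rewrite in_itv/= => /andP[h1 h2].
have h1' : z1 < x.
  by rewrite lt_neqAle h1 andbT; apply/eqP => E; move: rx; rewrite -E ltNge (ltW rz1).
have h2' : x < z2.
  by rewrite lt_neqAle h2 andbT; apply/eqP => E; move: rx; rewrite E ltNge (ltW rz2).
exists (z1, x, z2) => /=; split => //.
have D0 : is_derive x (1 : R) r 0.
  apply: (derive1_at_max (a := z1) (b := z2)) => //.
  - by move=> t _; case: (dr t).
  - by rewrite in_itv/= h1' h2'.
  - by move=> t; rewrite in_itv/= => /andP[t1 t2]; apply: xmax; rewrite in_itv/= !ltW.
have [_ e1] := D0; have [_ e2] := dr x.
by rewrite e1 in e2; lra.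
Qed.

End Oscillation.

(** * Periodic modes with oscillating amplitude *)

Section Modes.
Context {R : realType}.

Definition two_pi : R := pi *+ 2.

(** Smallness of eps keeps the conformal factor positive. *)
Lemma conformal_factor : exists eps : R, 0 < eps /\
  [/\ smooth1 (fun x => 1 + eps * profile2 x), forall x, 0 < 1 + eps * profile2 x &
      forall x, `|1 + eps * profile2 x| <= 2].
Proof.
have [B B0 HB] := @profile2_bound R.
have b x : `|(B * 2)^-1 * profile2 x| <= 2^-1.
  rewrite normrM ger0_norm ?invr_ge0 ?mulr_ge0// ?(ltW B0)// mulrC ler_pdivrMr ?mulr_gt0//.
  by rewrite mulrCA mulVf// mulr1.
exists (B * 2)^-1; split; first by rewrite invr_gt0 mulr_gt0.
split.
- move=> k; apply: kderD; first exact: kder_cst.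
  by apply: kderM; [exact: kder_cst|exact: smooth1_profile2].
- by move=> x; have := b x; rewrite ler_norml => /andP[? _]; lra.
- by move=> x; have := b x; rewrite !ler_norml => /andP[? ?]; apply/andP; split; lra.
Qed.

(** Bootstrap in the equation. *)
Lemma sol_smooth1 (V F F' : R -> R) : smooth1 V -> sol V F F' -> smooth1 F /\ smooth1 F'.
Proof.
move=> sV [d d']; suff H k : kder k F /\ kder k F' by split=> k; have [] := H k.
elim: k => // k [H H']; split; first by exists F'.
by exists (fun x => V x * F x) => //; exact: kderM.
Qed.

(** Arbitrarily close to 0 on the right there are points p.1.1 < p.1.2 < p.2
    such that the squared amplitude u^2 + v^2 is below 1 at the outer ones and
    has a critical value above 1 at the middle one, with nonzero second
    derivative; u2 and v2 stand for the second derivatives of u and v. *)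
Definition bumpy (u u' v v' u2 v2 : R -> R) := forall e : R, 0 < e -> exists p : R * R * R,
  [/\ [/\ 0 < p.1.1, p.1.1 < p.1.2, p.1.2 < p.2 & p.2 < e],
      u p.1.1 ^+ 2 + v p.1.1 ^+ 2 < 1, u p.2 ^+ 2 + v p.2 ^+ 2 < 1,
      1 < u p.1.2 ^+ 2 + v p.1.2 ^+ 2 &
      u p.1.2 * u' p.1.2 + v p.1.2 * v' p.1.2 = 0 /\
      u' p.1.2 ^+ 2 + v' p.1.2 ^+ 2 + u p.1.2 * u2 p.1.2 + v p.1.2 * v2 p.1.2 != 0].

(** The initial data are those of the plane wave (cos(w x), sin(w x)), for
    which the amplitude would be constant if Q were. *)
Lemma plane_wave_bumpy (eps l w : R) (u u' v v' : R -> R) : 0 < eps -> 0 < l ->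
  0 < w -> w ^+ 2 = l - two_pi ^+ 2 ->
  sol (potential (fun x => 1 + eps * profile2 x) two_pi l) u u' ->
  sol (potential (fun x => 1 + eps * profile2 x) two_pi l) v v' ->
  u 0 = 1 -> u' 0 = 0 -> v 0 = 0 -> v' 0 = w ->
  bumpy u u' v v' (fun x => potential (fun x => 1 + eps * profile2 x) two_pi l x * u x)
    (fun x => potential (fun x => 1 + eps * profile2 x) two_pi l x * v x).
Proof.
move=> e0 l0 w0 wE [du du'] [dv dv'] u0 u'0 v0 v'0.
set V := potential _ _ _ in du' dv' *.
pose r x := u x ^+ 2 + v x ^+ 2 - 1.
pose S x := u x * u' x + v x * v' x.
pose S1 x := u' x ^+ 2 + v' x ^+ 2 + V x * (u x ^+ 2 + v x ^+ 2).
pose mu := l * eps; pose V0 := w ^+ 2.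
have mu0 : 0 < mu by exact: mulr_gt0.
have V00 : 0 < V0 by rewrite exprn_gt0.
have VE x : V x = - V0 - mu * profile2 x by rewrite /V /potential /V0 wE /mu; ring.
pose Z x := S1 x + mu * (profile2 x * (1 + r x)) + 2 * V0 * r x.
have dr : der r (fun x => 2 * S x).
  apply: (der_ext (derB (derD (derM du du) (derM dv dv)) (der_cst 1))) => x; rewrite /r /S; ring.
have dS : der S S1.
  by apply: (der_eq (derD (derM du du') (derM dv dv'))) => x; rewrite /S1; ring.
have dS' : der S (S_deriv mu V0 r Z).
  by apply: (der_eq dS) => x; rewrite /S_deriv /Z; ring.
have [p3 dp _] := smooth1_has_der (@smooth1_profile2 R).
have dZ : der Z (fun x => - (2 * mu * (profile2 x * S x))).
  have dV : der V (fun x => - (mu * p3 x)).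
    apply: (der_ext (derB (der_cst (- V0)) (derZ mu dp))) => x; last by rewrite sub0r.
    by rewrite VE.
  have dq : der (fun x => u x ^+ 2 + v x ^+ 2) (fun x => 2 * S x).
    by apply: (der_ext (derD (derM du du) (derM dv dv))) => x; rewrite /S; ring.
  have dq' : der (fun x => u' x ^+ 2 + v' x ^+ 2) (fun x => 2 * (V x * S x)).
    by apply: (der_ext (derD (derM du' du') (derM dv' dv'))) => x; rewrite /S; ring.
  have d1 := derZ mu (derM dp (derD (der_cst 1) dr)).
  apply: (der_ext (derD (derD (derD dq' (derM dV dq)) d1) (derZ (2 * V0) dr))) => x.
    by rewrite /Z /S1; ring.
  by rewrite VE /r; ring.
have r0 : r 0 = 0 by rewrite /r u0 v0; ring.
have S0 : S 0 = 0 by rewrite /S u'0 v0; ring.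
have Z0 : Z 0 = 0.
  have [_ _ p20] := @profile_at0 R.
  by rewrite /Z /S1 VE p20 r0 u0 v0 u'0 v'0 /V0; ring.
have [d Hd] := @small_radius_ex R.
have [C C0 HC] := local_asymptotics mu0 V00 dr dS' dZ r0 S0 Z0 Hd.
have [e1 e10 nondeg] := nondegenerate mu0 C0 Hd HC.
move=> e he.
have m0 : 0 < Num.min e e1 by rewrite lt_min he.
have [p [[p1 p2 p3' p4] rz1 rz2 rx Sx]] := bumps mu0 C0 Hd dr HC m0.
have [p4e p4e1] : p.2 < e /\ p.2 < e1 by move: p4; rewrite lt_min => /andP.
exists p; split.
- by split.
- by move: rz1; rewrite /r; lra.
- by move: rz2; rewrite /r; lra.
- by move: rx; rewrite /r; lra.
- split => //; have := nondeg p.1.2 (lt_trans p1 p2) (lt_trans p3' p4e1) Sx.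
  by apply: contra => /eqP E; apply/eqP; rewrite -E /S_deriv /Z /S1; ring.
Qed.

(** A pair of periodic solutions, as needed for an eigenfunction u(x) cos(2 pi
    y) - v(x) sin(2 pi y). *)
Definition mode (Q : R -> R) (l : R) (u v : R -> R) := exists u' v' : R -> R,
  [/\ smooth1 u /\ smooth1 v, sol (potential Q two_pi l) u u' /\ sol (potential Q two_pi l) v v',
      (forall x, u (x + 1) = u x) /\ (forall x, v (x + 1) = v x) &
      bumpy u u' v v' (fun x => potential Q two_pi l x * u x) (fun x => potential Q two_pi l x * v x)].

(** Since all solutions are periodic for the chosen l, the plane wave data at
    0 are admissible. *)
Theorem modes : exists Q : R -> R, [/\ smooth1 Q, forall x, 0 < Q x,
  forall x, Q (x + 1) = Q x &
  forall L, exists l u v, [/\ L < l, 0 <= l & mode Q l u v]].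
Proof.
have [eps [e0 [sQ Qp Qb]]] := conformal_factor.
pose Q x := 1 + eps * profile2 x.
have QT x : Q (x + 3^-1) = Q x by rewrite /Q profile2_periodic.
(* a full turn is three periods *)
have three (x : R) : x + 1 = x + 3^-1 + 3^-1 + 3^-1 by field.
have Q0 : Q 0 = 1 by have [_ _ p0] := @profile_at0 R; rewrite /Q p0 mulr0 addr0.
have Qd0 Q' : der Q Q' -> Q' 0 = 0.
  have [p3 dp _] := smooth1_has_der (@smooth1_profile2 R) => dQ.
  rewrite (der_unique dQ (derD (der_cst 1) (derZ eps dp))).
  by rewrite (profile2_deriv0 dp) mulr0 addr0.
exists Q; split => //; first by move=> x; rewrite three !QT.
move=> L.
have T0 : 0 < 3^-1 :> R by rewrite invr_gt0.
have [l Ll [c [c' [s [s' [Sc Ss [c0 c'0 s0 s'0] tr]]]]]] :=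
  trace_minus_one two_pi sQ Qb T0 Qp QT Q0 Qd0 (Num.max L (two_pi ^+ 2)).
have [Ll' kl] : L < l /\ two_pi ^+ 2 < l by move: Ll; rewrite gt_max => /andP.
have l0 : 0 < l by apply: le_lt_trans kl; exact: sqr_ge0.
pose w := Num.sqrt (l - two_pi ^+ 2).
have wE : w ^+ 2 = l - two_pi ^+ 2 by rewrite sqr_sqrtr// subr_ge0 ltW.
have w0 : 0 < w by rewrite sqrtr_gt0 subr_gt0.
have WT x : potential Q two_pi l (x + 3^-1) = potential Q two_pi l x by rewrite /potential QT.
have per F F' : sol (potential Q two_pi l) F F' -> forall x, F (x + 1) = F x.
  move=> SF x; have := sol_period3 (potential_bound two_pi Qb l) WT Sc Ss c0 c'0 s0 s'0 tr SF x.
  by move=> <-; congr F; field.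
have sW : smooth1 (potential Q two_pi l).
  move=> k; apply: kderD; first exact: kder_cst.
  by apply: kderN; apply: kderM; [exact: kder_cst|exact: sQ].
have Sv : sol (potential Q two_pi l) (fun x => w * s x) (fun x => w * s' x).
  have [a b] := sol_lin w 0 Ss Ss; split.
    by apply: (der_ext a) => x; rewrite mul0r addr0.
  by apply: (der_ext b) => x; rewrite mul0r addr0.
exists l, c, (fun x => w * s x); split => //; first exact: ltW.
exists c', (fun x => w * s' x); split.
- by split; [exact: (sol_smooth1 sW Sc).1|exact: (sol_smooth1 sW Sv).1].
- by split.
- by split; [exact: per Sc|exact: per Sv].
- by apply: (plane_wave_bumpy e0 l0 w0 wE Sc Sv) => //; rewrite ?s0 ?s'0 ?mulr0 ?mulr1.
Qed.

End Modes.

(** * Functions and conformal metrics on the torus *)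

Section TorusFunctions.
Context {R : realType}.
Local Notation plane := 'rV[R]_2.
Implicit Types (x y z : plane) (a b c e u v : R -> R) (p q : torus R).

Lemma repr_pi x : torus_repr (torus_pi x) - x \is a mxOver Num.int.
Proof.
apply/(@eqmodP _ (@lattice_equiv R) (torus_repr (torus_pi x)) x).
exact: (reprK (torus_pi x)).
Qed.

Lemma pi_eq x y : x - y \is a mxOver Num.int -> torus_pi x = torus_pi y.
Proof. by move=> h; apply/(@eqmodP _ (@lattice_equiv R) x y). Qed.

Lemma periodic_int (V : Type) (f : R -> V) : (forall t, f (t + 1) = f t) ->
  forall s t, s - t \is a Num.int -> f s = f t.
Proof.
move=> H s t /intrP[m E]; have -> : s = t + m%:~R by rewrite -E; ring.
have K (n : nat) r : f (r + n%:R) = f r.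
  by elim: n r => [|n IH] r; rewrite ?addr0// -natr1 addrA H IH.
case: m {E} => n; first exact: K.
rewrite -[LHS](K n.+1) NegzE mulrNz; congr f; exact: subrK.
Qed.

(** A function of two real variables read on the representatives; it is the
    function on the torus that it should be only when it is 1-periodic in each
    variable. *)
Definition tfun (f : R -> R -> R) p : R := f (torus_repr p 0 0) (torus_repr p 0 1).

Lemma lift_tfun (f : R -> R -> R) : (forall s t, f (s + 1) t = f s t) ->
  (forall s t, f s (t + 1) = f s t) ->
  lift_fun (tfun f) = (fun x => f (x 0 0) (x 0 1)).
Proof.
move=> H1 H2; apply/funext => x; rewrite /lift_fun /= /tfun.
have := repr_pi x => /mxOverP h; have := h 0 0; have := h 0 1; rewrite !mxE => h1 h0.
rewrite (periodic_int (f := f ^~ (torus_repr (torus_pi x) 0 1)) _ h0); last by move=> t; exact: H1.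
exact: (periodic_int (H2 _) h1).
Qed.

Lemma I2_cases (i : 'I_2) : i = 0 \/ i = 1.
Proof. by case: i => [[|[|//]] h]; [left|right]; exact: val_inj. Qed.

Definition tensor a b x : R := a (x 0 0) * b (x 0 1).

Lemma differentiable_coordfun a a' (j : 'I_2) x : der a a' ->
  differentiable (fun x : plane => a (x 0 j)) x.
Proof.
move=> d; apply: (@differentiable_comp _ _ _ _ (fun x : plane => x 0 j) a).
  exact: differentiable_coord.
by apply/derivable1_diffP; case: (d (x 0 j)).
Qed.

Lemma differentiable_tensor a a' b b' x : der a a' -> der b b' -> differentiable (tensor a b) x.
Proof.
by move=> da db; apply: differentiableM; [exact: differentiable_coordfun da|exact: differentiable_coordfun db].
Qed.

(** A derivative along a coordinate axis is a derivative in one variable. *)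
Lemma is_derive_coord (i : 'I_2) (f : plane -> R) (g : R -> R) x (d : R) :
  (forall h : R, f (h *: delta_mx 0 i + x) = g (h + x 0 i)) ->
  is_derive (x 0 i) (1 : R) g d -> is_derive x (delta_mx 0 i) f d.
Proof.
move=> H [dg eg].
have E : (fun h : R => h^-1 *: (f (h *: delta_mx 0 i + x) - f x)) =
  (fun h : R => h^-1 *: (g (h *: 1 + x 0 i) - g (x 0 i))).
  apply/funext => h; rewrite H -[in f x](add0r x) -[in f _](scale0r (delta_mx 0 i)) H add0r.
  by rewrite /GRing.scale/= mulr1.
by split; [move: dg|move: eg]; rewrite /derivable /derive /= E.
Qed.

Lemma is_derive_tensor_x a a' b x : der a a' ->
  is_derive x (delta_mx 0 (0 : 'I_2)) (tensor a b) (tensor a' b x).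
Proof.
move=> d; apply: (is_derive_coord (g := fun t => a t * b (x 0 1))).
  by move=> h; rewrite /tensor !mxE /= mulr1 mulr0 add0r.
by have := derM d (der_cst (b (x 0 1))) (x 0 0); rewrite mulr0 addr0.
Qed.

Lemma is_derive_tensor_y a b b' x : der b b' ->
  is_derive x (delta_mx 0 (1 : 'I_2)) (tensor a b) (tensor a b' x).
Proof.
move=> d; apply: (is_derive_coord (g := fun t => a (x 0 0) * b t)).
  by move=> h; rewrite /tensor !mxE /= mulr1 mulr0 add0r.
by have := derM (der_cst (a (x 0 0))) d (x 0 1); rewrite mul0r add0r.
Qed.

(** Sums of two products a(x) b(y): a class stable under partial derivatives
    that contains all functions needed here. *)
Definition tensor2 a b c e x : R := tensor a b x + tensor c e x.

Lemma differentiable_tensor2 a a' b b' c c' e e' x : der a a' -> der b b' ->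
  der c c' -> der e e' -> differentiable (tensor2 a b c e) x.
Proof.
move=> da db dc de; apply: differentiableD; first exact: differentiable_tensor da db.
exact: differentiable_tensor dc de.
Qed.

Lemma is_derive_tensor2_x a a' b c c' e x : der a a' -> der c c' ->
  is_derive x (delta_mx 0 (0 : 'I_2)) (tensor2 a b c e) (tensor2 a' b c' e x).
Proof.
by move=> da dc; apply: is_deriveD; exact: is_derive_tensor_x.
Qed.

Lemma is_derive_tensor2_y a b b' c e e' x : der b b' -> der e e' ->
  is_derive x (delta_mx 0 (1 : 'I_2)) (tensor2 a b c e) (tensor2 a b' c e' x).
Proof.
by move=> da dc; apply: is_deriveD; exact: is_derive_tensor_y.
Qed.

Lemma partial_tensor2_x a a' b c c' e : der a a' -> der c c' ->
  partial 0 (tensor2 a b c e) = tensor2 a' b c' e.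
Proof.
by move=> da dc; apply/funext => x; have [_] := is_derive_tensor2_x b e x da dc.
Qed.

Lemma partial_tensor2_y a b b' c e e' : der b b' -> der e e' ->
  partial 1 (tensor2 a b c e) = tensor2 a b' c e'.
Proof.
by move=> da dc; apply/funext => x; have [_] := is_derive_tensor2_y a c x da dc.
Qed.

Lemma Ck_tensor2 k a b c e : smooth1 a -> smooth1 b -> smooth1 c -> smooth1 e ->
  Ck k (tensor2 a b c e).
Proof.
elim: k a b c e => [|k IH] a b c e sa sb sc se.
all: have [a' da sa'] := smooth1_has_der sa; have [b' db sb'] := smooth1_has_der sb.
all: have [c' dc sc'] := smooth1_has_der sc; have [e' de se'] := smooth1_has_der se.
all: have cf : continuous (tensor2 a b c e)
  by move=> x; exact: differentiable_continuous (differentiable_tensor2 x da db dc de).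
  exact: cf.
split => // i; have [->|->] := I2_cases i.
  split; first by move=> x; case: (is_derive_tensor2_x b e x da dc).
  by rewrite (partial_tensor2_x b e da dc); exact: IH.
split; first by move=> x; case: (is_derive_tensor2_y a c x db de).
by rewrite (partial_tensor2_y a c db de); exact: IH.
Qed.

(** The differential is the linear map given by the partial derivatives. *)
Lemma diff_coordinates (f : plane -> R) x (w : plane) : differentiable f x ->
  'd f x w = w 0 0 * 'D_(delta_mx 0 0) f x + w 0 1 * 'D_(delta_mx 0 1) f x.
Proof.
move=> df; rewrite !deriveE//.
have {1}-> : w = w 0 0 *: delta_mx 0 0 + w 0 1 *: delta_mx 0 1.
  apply/rowP => j; rewrite !mxE; have [->|->] := I2_cases j; rewrite /= ?mulr1 ?mulr0 ?addr0 ?add0r//.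
by rewrite linearD !linearZ.
Qed.

Lemma critical_tensor2 (f : R -> R -> R) a a' b b' c c' e e' p :
  lift_fun (tfun f) = tensor2 a b c e ->
  der a a' -> der b b' -> der c c' -> der e e' ->
  critical_point (tfun f) p <->
  tensor2 a' b c' e (torus_repr p) = 0 /\ tensor2 a b' c e' (torus_repr p) = 0.
Proof.
move=> E da db dc de; rewrite /critical_point E; set x := torus_repr p.
have df := differentiable_tensor2 x da db dc de.
have d0 := partial_tensor2_x b e da dc; have d1 := partial_tensor2_y a c db de.
have {}d0 : 'D_(delta_mx 0 0) (tensor2 a b c e) x = tensor2 a' b c' e x by rewrite -d0.
have {}d1 : 'D_(delta_mx 0 1) (tensor2 a b c e) x = tensor2 a b' c e' x by rewrite -d1.
split=> [H|[h0 h1] w]; last by rewrite (diff_coordinates w df) d0 d1 h0 h1 !mulr0 addr0.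
split.
  by have := H (delta_mx 0 0); rewrite (diff_coordinates _ df) d0 d1 !mxE /= mul1r mul0r addr0.
by have := H (delta_mx 0 1); rewrite (diff_coordinates _ df) d0 d1 !mxE /= mul1r mul0r add0r.
Qed.

Lemma tfun_x_lift a : (forall t, a (t + 1) = a t) ->
  lift_fun (tfun (fun s _ => a s)) = (fun x => a (x 0 0)).
Proof. by move=> H; apply: lift_tfun. Qed.

Section metric.
Variables (Q : R -> R).
Hypotheses (Qs : smooth1 Q) (Qp : forall t, 0 < Q t) (Q1 : forall t, Q (t + 1) = Q t).

Definition conformal_gram p : 'M[R]_2 := (tfun (fun s _ => Q s) p)%:M.

Lemma conformal_gram_smooth i j : smooth (fun p => conformal_gram p i j).
Proof.
move=> k.
have -> : lift_fun (fun p => conformal_gram p i j) =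
    tensor2 (fun t => (i == j)%:R * Q t) (fun=> 1) (fun=> 0) (fun=> 0).
  apply/funext => x; rewrite /lift_fun /= /conformal_gram mxE /tensor2 /tensor.
  have -> : tfun (fun s _ => Q s) (torus_pi x) = Q (x 0 0).
    by rewrite -[RHS](congr1 (fun f => f x) (tfun_x_lift Q1)).
  by rewrite mulr0 addr0 mulr1 mulr_natl.
apply: Ck_tensor2; try by move=> ?; exact: kder_cst.
by move=> n; apply: kderM; [exact: kder_cst|exact: Qs].
Qed.

Lemma conformal_gram_sym p : (conformal_gram p)^T = conformal_gram p.
Proof. by rewrite /conformal_gram tr_scalar_mx. Qed.

Lemma conformal_gram_pos p (w : 'rV[R]_2) : w != 0 -> 0 < (w *m conformal_gram p *m w^T) 0 0.
Proof.
move=> w0; rewrite /conformal_gram mul_mx_scalar -scalemxAl mxE mulr_gt0 ?Qp//.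
rewrite mxE lt_neqAle; apply/andP; split; last by apply: sumr_ge0 => j _; rewrite mxE -expr2 sqr_ge0.
apply: contra w0 => /eqP /esym H; apply/eqP/rowP => j; rewrite mxE.
have pos i : predT i -> 0 <= w 0 i * w^T i 0 by move=> _; rewrite mxE -expr2 sqr_ge0.
have /eqP := psumr_eq0P pos H (isT : predT j).
by rewrite mxE mulf_eq0 orbb => /eqP.
Qed.

Definition conformal_metric : riemannian_metric R :=
  RiemannianMetric conformal_gram_smooth conformal_gram_sym conformal_gram_pos.

(** In dimension 2 the matrix |g|^(1/2) g^(-1) of a conformal metric is the
    identity. *)
Lemma conformal_laplace (f : torus R -> R) p :
  laplace_beltrami conformal_metric f p =
  (Q (torus_repr p 0 0))^-1 * (partial 0 (partial 0 (lift_fun f)) (torus_repr p)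
     + partial 1 (partial 1 (lift_fun f)) (torus_repr p)).
Proof.
rewrite /laplace_beltrami.
have G y : lift_fun conformal_metric y = (Q (y 0 0))%:M.
  have -> : lift_fun conformal_metric y = (lift_fun (tfun (fun s _ => Q s)) y)%:M by [].
  by rewrite (tfun_x_lift Q1).
have vol y : Num.sqrt (\det (lift_fun conformal_metric y)) = Q (y 0 0).
  by rewrite G det_scalar sqrtr_sqr ger0_norm// ltW.
have E i j : (fun y => Num.sqrt (\det (lift_fun conformal_metric y)) *
     invmx (lift_fun conformal_metric y) i j * partial j (lift_fun f) y) =
   if i == j then partial j (lift_fun f) else cst 0.
  apply/funext => y; rewrite vol G invmx_scalar mxE; case: eqP => _ /=.
    by rewrite mulr1n divff ?lt0r_neq0// mul1r.
  by rewrite mulr0n mulr0 mul0r.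
have sum2 (F : 'I_2 -> R) : \sum_(i < 2) F i = F 0 + F 1.
  by rewrite big_ord_recl big_ord1; congr (_ + F _); exact: val_inj.
have D0 i x : partial i (cst 0 : plane -> R) x = 0 by rewrite /partial derive_cst.
rewrite vol; congr (_ * _); rewrite !sum2 (E 0 0) (E 0 1) (E 1 0) (E 1 1).
have -> : ((0 : 'I_2) == 1) = false by [].
have -> : ((1 : 'I_2) == 0) = false by [].
by rewrite !eqxx !D0 addr0 add0r.
Qed.

End metric.
End TorusFunctions.

(** * Counting components and isolated points *)

Section Topology.
Context {R : realType}.

Lemma infinite_of_inj {T : Type} (A : set T) (f : nat -> T) :
  (forall n, A (f n)) -> injective f -> infinite_set A.
Proof.
move=> Af inj fA; apply: infinite_nat.
have sub : f @` setT `<=` A by move=> _ [n _ <-].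
have := sub_finite_set sub fA.
by rewrite (eq_finite_set (inj_card_eq _))// => m n _ _; exact: inj.
Qed.

(** The image of a connected set is an interval. *)
Lemma connected_sign {T : topologicalType} (C : set T) (f : T -> R) p q :
  connected C -> continuous f -> (forall x, C x -> f x != 0) -> C p -> C q ->
  0 < f p -> 0 < f q.
Proof.
move=> cC cf nz Cp Cq fp.
have /connected_intervalP itv : connected (f @` C).
  by apply: connected_continuous_connected => //; exact: continuous_subspaceT.
rewrite ltNge; apply/negP => fq.
have [] : (f @` C) 0.
  apply: (itv (f q) (f p)); [by exists q|by exists p|by rewrite fq (ltW fp)].
by move=> x Cx fx; have := nz x Cx; rewrite fx eqxx.
Qed.

(** The functions psi n separate the points: psi n is positive at the n-th
    point and negative at the others, but it has no zero on the component of
    the n-th point. *)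
Lemma infinite_components {T : topologicalType} (A : set T) (P : nat -> T)
    (psi : nat -> T -> R) :
  (forall n, A (P n)) -> (forall n, continuous (psi n)) ->
  (forall n q, connected_component A (P n) q -> psi n q != 0) ->
  (forall n, 0 < psi n (P n)) -> (forall m n, m <> n -> psi n (P m) < 0) ->
  infinite_set (connected_component A @` A).
Proof.
move=> AP cpsi nz pos neg.
apply: (@infinite_of_inj _ _ (fun n => connected_component A (P n))).
  by move=> n; exists (P n).
move=> n m E; apply: contrapT => nm.
have Cn := connected_component_refl (AP n); have Cm := connected_component_refl (AP m).
rewrite -E in Cm.
have := connected_sign (component_connected (A := A) (x := P n)) (cpsi n) (nz n) Cn Cm (pos n).
by rewrite ltNge ltW// neg// => mn; apply: nm.
Qed.

(** Caratheodory's form of the derivative: f(t) = g(t) (t - x) with g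
    continuous and nonzero at x. *)
Lemma isolated_zero (f f' : R -> R) x : der f f' -> f x = 0 -> f' x != 0 ->
  exists2 e : R, 0 < e & forall t, `|t - x| < e -> f t = 0 -> t = x.
Proof.
move=> df fx nz; have /is_derive1_caratheodory [g [gE cg gx]] := df x.
have : \forall t \near x, g t != 0.
  have gx0 : 0 < `|g x| by rewrite normr_gt0 gx.
  have /cvgrPdist_lt/(_ _ gx0) := cg; apply: filterS => t.
  by apply: contraL => /eqP ->; rewrite subr0 ltxx.
move=> /nbhs_ballP[e /= e0 He]; exists e => // t tx ft.
have := gE t; rewrite ft fx subr0 => /esym/eqP; rewrite mulf_eq0.
have /negbTE -> /= : g t != 0 by apply: He; rewrite /ball/= distrC.
by rewrite subr_eq0 => /eqP.
Qed.

(** Polar coordinates. *)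
Lemma polar (a b : R) : 0 < a ^+ 2 + b ^+ 2 -> exists al : R,
  a = Num.sqrt (a ^+ 2 + b ^+ 2) * cos al /\ b = Num.sqrt (a ^+ 2 + b ^+ 2) * sin al.
Proof.
move=> h; set rho := Num.sqrt _.
have r0 : 0 < rho by rewrite sqrtr_gt0.
have r2 : rho ^+ 2 = a ^+ 2 + b ^+ 2 by rewrite sqr_sqrtr// ltW.
have rn : rho != 0 by exact: lt0r_neq0.
have c2 : (a / rho) ^+ 2 <= 1.
  by rewrite exprMn exprVn r2 ler_pdivrMr// mul1r lerDl sqr_ge0.
have c1 : -1 <= a / rho <= 1.
  have : `|a / rho| ^+ 2 <= 1 ^+ 2 by rewrite real_normK ?num_real// expr1n.
  by rewrite ler_sqr ?nnegrE// ler_norml.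
have cosE : rho * cos (acos (a / rho)) = a by rewrite acosK ?in_itv//= mulrC divfK.
have sinE : rho * sin (acos (a / rho)) = `|b|.
  have wE : 1 - (a / rho) ^+ 2 = (b / rho) ^+ 2.
    by apply: (mulIf (expf_neq0 2 rn)); rewrite mulrBl mul1r -!exprMn !divfK// r2; ring.
  by rewrite sin_acos// wE sqrtr_sqr normrM normfV (ger0_norm (ltW r0)) mulrC divfK.
have [b0|b0] := leP 0 b.
  by exists (acos (a / rho)); rewrite cosE sinE ger0_norm.
exists (- acos (a / rho)); rewrite cosN sinN cosE; split => //.
by rewrite mulrN sinE ltr0_norm// opprK.
Qed.

(** The square of sin(pi t) has period 1, and sin(pi t) > 0 for 0 < t < 1. *)
Lemma sin_pi_eq0 (t : R) : sin (pi * t) = 0 -> t \is a Num.int.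
Proof.
move=> h.
pose f (s : R) := sin (pi * s) ^+ 2.
have fp s : f (s + 1) = f s by rewrite /f mulrDr mulr1 sinDpi sqrrN.
pose r := t - (Num.floor t)%:~R.
have rt : r - t \is a Num.int by rewrite /r addrC addKr rpredN intr_int.
have f0 : sin (pi * r) = 0.
  by apply/eqP; rewrite -sqrf_eq0 -/(f r) (periodic_int fp rt) /f h expr0n.
have r0 : 0 <= r by rewrite subr_ge0 floor_le.
have r1 : r < 1 by have := floorD1_gt t; rewrite intrD /r; lra.
have rE : r = 0.
  apply/eqP; rewrite eq_le r0 andbT leNgt; apply/negP => rp.
  have := @sin_gt0_pi R (pi * r).
  by rewrite mulr_gt0 ?pi_gt0//= gtr_pMr ?pi_gt0// r1 f0 ltxx => /(_ isT).
by move: rt; rewrite rE sub0r rpredN.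
Qed.

End Topology.

(** * The eigenfunctions *)

Section Eigen.
Context {R : realType}.
Variables (Q : R -> R).
Hypotheses (Qs : smooth1 Q) (Qp : forall t, 0 < Q t) (Q1 : forall t, Q (t + 1) = Q t).
Local Notation g := (conformal_metric Qs Qp Q1).

Lemma const_eigen : eigenfunction g 0 (cst 1).
Proof.
have E : lift_fun (cst 1 : torus R -> R) = tensor2 (fun=> 1) (fun=> 1) (fun=> 0) (fun=> 0).
  by apply/funext => x; rewrite /lift_fun /= /tensor2 /tensor mulr1 mulr0 addr0.
have s1 (c : R) : smooth1 (fun=> c) by move=> k; exact: kder_cst.
split => //.
- by move=> k; rewrite E; exact: Ck_tensor2.
- by exists (torus_pi 0); rewrite /cst oner_eq0.
- move=> p; rewrite conformal_laplace E mul0r addr0.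
  rewrite !(partial_tensor2_x _ _ (der_cst _) (der_cst _)) !(partial_tensor2_y _ _ (der_cst _) (der_cst _)).
  by rewrite /tensor2 /tensor !mulr0 !mul0r !addr0 mulr0.
Qed.

Definition cs (t : R) : R := cos (two_pi * t).
Definition sn (t : R) : R := sin (two_pi * t).

Lemma der_cs : der cs (fun t => - two_pi * sn t).
Proof.
apply: (der_eq (der_comp (@der_cos R) (derZ two_pi (@der_id R)))) => t.
by rewrite /sn; ring.
Qed.

Lemma der_sn : der sn (fun t => two_pi * cs t).
Proof.
apply: (der_eq (der_comp (@der_sin R) (derZ two_pi (@der_id R)))) => t.
by rewrite /cs; ring.
Qed.

Lemma smooth1_cs : smooth1 cs.
Proof.
move=> k; apply: (kder_comp (f := @cos R)); first by move=> j; have [] := @kder_sincos R j.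
by apply: kderM; [exact: kder_cst|exact: smooth1_id].
Qed.

Lemma smooth1_sn : smooth1 sn.
Proof.
move=> k; apply: (kder_comp (f := @sin R)); first by move=> j; have [] := @kder_sincos R j.
by apply: kderM; [exact: kder_cst|exact: smooth1_id].
Qed.

Lemma cs1 t : cs (t + 1) = cs t.
Proof. by rewrite /cs mulrDr mulr1 cosD2pi. Qed.

Lemma sn1 t : sn (t + 1) = sn t.
Proof. by rewrite /sn mulrDr mulr1 sinD2pi. Qed.

Section mode.
Variables (l : R) (u v u' v' : R -> R).
Hypotheses (l0 : 0 <= l) (su : smooth1 u) (sv : smooth1 v)
  (Su : sol (potential Q two_pi l) u u') (Sv : sol (potential Q two_pi l) v v')
  (u1 : forall t, u (t + 1) = u t) (v1 : forall t, v (t + 1) = v t).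
Let u2 t := potential Q two_pi l t * u t.
Let v2 t := potential Q two_pi l t * v t.
Hypothesis bump : bumpy u u' v v' u2 v2.

(** The real part of (u + i v)(x) exp(2 pi i y). *)
Definition wave : torus R -> R := tfun (fun s t => u s * cs t + (- v s) * sn t).

Let nv t := - v t.

Lemma wave_lift : lift_fun wave = tensor2 u cs nv sn.
Proof.
by apply: lift_tfun => s t; rewrite ?u1 ?v1 ?cs1 ?sn1.
Qed.

Let dnv : der nv (fun t => - v' t). Proof. by case: Sv => d _; exact: derN. Qed.
Let snv : smooth1 nv. Proof. by move=> k; exact: kderN. Qed.

Let dphi1 : partial 1 (tensor2 u cs nv sn) =
  tensor2 u (fun t => - two_pi * sn t) nv (fun t => two_pi * cs t).
Proof. exact: partial_tensor2_y der_cs der_sn. Qed.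

Lemma wave_val x : wave (torus_pi x) = u (x 0 0) * cs (x 0 1) - v (x 0 0) * sn (x 0 1).
Proof.
by rewrite -[LHS]/(lift_fun wave x) wave_lift /tensor2 /tensor /nv mulNr.
Qed.

Lemma wave_cont : continuous wave.
Proof.
apply/(@quotient_continuous _ {eq_quot (@lattice_equiv R)}%qT _ wave).
have : continuous (lift_fun wave); last by [].
rewrite wave_lift => x; apply: differentiable_continuous.
by have [d _] := Su; exact: differentiable_tensor2 d der_cs dnv der_sn.
Qed.

Lemma wave_eigen : eigenfunction g l wave.
Proof.
split => //.
- by move=> k; rewrite wave_lift; apply: Ck_tensor2 => //; [exact: smooth1_cs|exact: smooth1_sn].
- have [p [[p1 p2 p3 p4] _ _ h _]] := bump ltr01.
  pose x (t : R) : 'rV[R]_2 := \row_j (if j == 0 then p.1.2 else t).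
  have E t : wave (torus_pi (x t)) = u p.1.2 * cs t - v p.1.2 * sn t by rewrite wave_val !mxE.
  have [u0|u0] := eqVneq (u p.1.2) 0.
    exists (torus_pi (x (4^-1))); rewrite E u0 mul0r sub0r oppr_eq0.
    have -> : sn (4^-1) = 1 by rewrite /sn /two_pi (_ : _ * _ = pi / 2) ?sin_pihalf//; field.
    rewrite mulr1; apply/eqP => v0.
    by move: h; rewrite u0 v0 expr0n addr0 ltr10.
  exists (torus_pi (x 0)); rewrite E /cs /sn mulr0 cos0 sin0 mulr0 subr0 mulr1 //.
- move=> p; rewrite conformal_laplace wave_lift dphi1.
  have [du du'] := Su; have [dv dv'] := Sv.
  rewrite (partial_tensor2_x cs sn du dnv) (partial_tensor2_x cs sn du' (derN dv')).
  rewrite (partial_tensor2_y u nv (derZ (- two_pi) der_sn) (derZ two_pi der_cs)).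
  set x := torus_repr p.
  have -> : wave p = tensor2 u cs nv sn x by [].
  rewrite /tensor2 /tensor /nv /potential.
  by field; exact: lt0r_neq0.
Qed.

(** By Cauchy-Schwarz the square of the wave is at most u^2 + v^2. *)
Lemma wave_lt1 (p : torus R) z : u z ^+ 2 + v z ^+ 2 < 1 ->
  torus_repr p 0 0 - z \is a Num.int -> wave p < 1.
Proof.
move=> h pz; rewrite /wave /tfun (periodic_int u1 pz) (periodic_int v1 pz).
set t := torus_repr p 0 1.
have c2 : cs t ^+ 2 + sn t ^+ 2 = 1 by rewrite /cs /sn cos2Dsin2.
rewrite ltNge; apply/negP => k.
have k2 : 1 <= (u z * cs t + - v z * sn t) ^+ 2 by rewrite -[leLHS](expr1n _ 2) ler_sqr ?nnegrE//; lra.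
have : (u z * cs t + - v z * sn t) ^+ 2 + (u z * sn t + v z * cs t) ^+ 2 = u z ^+ 2 + v z ^+ 2.
  transitivity ((u z ^+ 2 + v z ^+ 2) * (cs t ^+ 2 + sn t ^+ 2)); first by ring.
  by rewrite c2 mulr1.
have := sqr_ge0 (u z * sn t + v z * cs t); lra.
Qed.

(** On a vertical circle the wave is sqrt(u^2 + v^2) times a cosine: its
    maximum, where the derivative in y vanishes, exceeds 1, and it takes the
    value 1. *)
Lemma wave_phase (x : R) : 1 < u x ^+ 2 + v x ^+ 2 ->
  (exists y, 1 < u x * cs y - v x * sn y /\ u x * sn y + v x * cs y = 0) /\
  (exists y, u x * cs y - v x * sn y = 1).
Proof.
move=> h; have [al [E1 E2]] := polar (lt_trans ltr01 h).
set rho := Num.sqrt _ in E1 E2.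
have r1 : 1 < rho by rewrite -sqrtr1 ltr_sqrt// (lt_trans ltr01).
have k0 : two_pi != 0 :> R by rewrite mulrn_eq0/= lt0r_neq0// pi_gt0.
have ev b : u x * cs ((b - al) / two_pi) - v x * sn ((b - al) / two_pi) = rho * cos b.
  have -> : cos b = cos (al + (b - al)) by congr cos; ring.
  by rewrite cosD /cs /sn [two_pi * _]mulrC divfK// E1 E2; ring.
split.
  exists ((0 - al) / two_pi); split; first by rewrite ev cos0 mulr1.
  rewrite /cs /sn [two_pi * _]mulrC divfK// sub0r cosN sinN E1 E2; ring.
exists ((acos rho^-1 - al) / two_pi); rewrite ev acosK ?divff ?lt0r_neq0//.
  by rewrite (lt_trans ltr01).
have i0 : 0 < rho^-1 by rewrite invr_gt0 (lt_trans ltr01).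
rewrite in_itv/=; apply/andP; split; first lra.
by rewrite invf_le1 ?ltW// (lt_trans ltr01).
Qed.

(** Each triple is chosen to the left of the preceding one. *)
Lemma nested_bumps : exists z1 x z2 : nat -> R,
  [/\ forall n, [/\ 0 < z1 n, z1 n < x n, x n < z2 n & z2 n < 2^-1],
      forall m n, (m < n)%N -> z2 n < z1 m &
      forall n, [/\ u (z1 n) ^+ 2 + v (z1 n) ^+ 2 < 1, u (z2 n) ^+ 2 + v (z2 n) ^+ 2 < 1,
        1 < u (x n) ^+ 2 + v (x n) ^+ 2, u (x n) * u' (x n) + v (x n) * v' (x n) = 0 &
        u' (x n) ^+ 2 + v' (x n) ^+ 2 + u (x n) * u2 (x n) + v (x n) * v2 (x n) != 0]].
Proof.
have B e : exists p : R * R * R, 0 < e ->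
   [/\ [/\ 0 < p.1.1, p.1.1 < p.1.2, p.1.2 < p.2 & p.2 < e],
     u p.1.1 ^+ 2 + v p.1.1 ^+ 2 < 1, u p.2 ^+ 2 + v p.2 ^+ 2 < 1,
     1 < u p.1.2 ^+ 2 + v p.1.2 ^+ 2 &
     u p.1.2 * u' p.1.2 + v p.1.2 * v' p.1.2 = 0 /\
     u' p.1.2 ^+ 2 + v' p.1.2 ^+ 2 + u p.1.2 * u2 p.1.2 + v p.1.2 * v2 p.1.2 != 0].
  have [e0|e0] := ltP 0 e; last by exists (0, 0, 0).
  by have [p Hp] := bump e0; exists p.
have [F HF] := choice B.
pose s := fix s n : R * R * R := if n is n'.+1 then F (s n').1.1 else F 2^-1.
have half : 0 < 2^-1 :> R by rewrite invr_gt0.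
have pos n : 0 < (s n).1.1.
  by elim: n => [|n IH] /=; [have [[]] := HF _ half|have [[]] := HF _ IH].
have lth n : (s n.+1).2 < (s n).1.1 by have [[]] := HF _ (pos n).
have ord n : (s n).1.1 < (s n).1.2 /\ (s n).1.2 < (s n).2.
  by case: n => [|n]; [have [[]] := HF _ half|have [[]] := HF _ (pos n)].
have mono m n : (m < n)%N -> (s n).2 < (s m).1.1.
  elim: n => // n IH; rewrite ltnS leq_eqVlt => /orP[/eqP ->|/IH h]; first exact: lth.
  by apply: lt_trans (lth n) _; have [k1 k2] := ord n; exact: lt_trans k1 (lt_trans k2 h).
have s0h : (s 0%N).2 < 2^-1 by have [[]] := HF _ half.
exists (fun n => (s n).1.1), (fun n => (s n).1.2), (fun n => (s n).2); split => //.
- move=> n; have [k1 k2] := ord n; split => //.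
  case: n k1 k2 => [//|n] k1 k2; apply: lt_trans (mono 0%N n.+1 isT) _.
  by have [k3 k4] := ord 0%N; exact: lt_trans k3 (lt_trans k4 s0h).
- move=> n; have [_ h1 h2 h3 [h4 h5]] : [/\ [/\ 0 < (s n).1.1, (s n).1.1 < (s n).1.2, (s n).1.2 < (s n).2 & True],
     u (s n).1.1 ^+ 2 + v (s n).1.1 ^+ 2 < 1, u (s n).2 ^+ 2 + v (s n).2 ^+ 2 < 1,
     1 < u (s n).1.2 ^+ 2 + v (s n).1.2 ^+ 2 &
     u (s n).1.2 * u' (s n).1.2 + v (s n).1.2 * v' (s n).1.2 = 0 /\
     u' (s n).1.2 ^+ 2 + v' (s n).1.2 ^+ 2 + u (s n).1.2 * u2 (s n).1.2 + v (s n).1.2 * v2 (s n).1.2 != 0].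
    by case: n => [|n]; [have [[? ? ? ?] ? ? ? ?] := HF _ half|have [[? ? ? ?] ? ? ? ?] := HF _ (pos n)]; split.
  by split.
Qed.

End mode.
End Eigen.

(** * Critical points, level sets and nodal domains *)

Section WaveGeometry.
Context {R : realType}.
Variables (Q : R -> R).
Variables (l : R) (u v u' v' : R -> R).
Hypotheses (su : smooth1 u) (sv : smooth1 v)
  (Su : sol (potential Q two_pi l) u u') (Sv : sol (potential Q two_pi l) v v')
  (u1 : forall t, u (t + 1) = u t) (v1 : forall t, v (t + 1) = v t).
Let u2 t := potential Q two_pi l t * u t.
Let v2 t := potential Q two_pi l t * v t.
Hypothesis bump : bumpy u u' v v' u2 v2.

Local Notation plane := 'rV[R]_2.
Local Notation phi := (wave u v).

Definition pt (s t : R) : plane := \row_j (if j == 0 then s else t).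

Lemma pt0 s t : pt s t 0 0 = s. Proof. by rewrite mxE. Qed.
Lemma pt1 s t : pt s t 0 1 = t. Proof. by rewrite mxE. Qed.

Lemma sin_pi_gt0 (t : R) : 0 < t -> t < 1 -> 0 < sin (pi * t).
Proof.
move=> t0 t1; apply: sin_gt0_pi.
by rewrite mulr_gt0 ?pi_gt0//= gtr_pMr ?pi_gt0.
Qed.

Lemma sin_pi_lt0 (t : R) : -1 < t -> t < 0 -> sin (pi * t) < 0.
Proof.
move=> t1 t0; have : 0 < sin (pi * - t) by apply: sin_pi_gt0; lra.
by rewrite mulrN sinN oppr_gt0.
Qed.

(** Of period 1 and zero exactly at z1 and z2 modulo 1. If z1 < z2 are in ]0,
    1/2[ then, on that interval, it is positive exactly between z1 and z2. Two
    circles are used because one circle does not disconnect the torus. *)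
Definition strip_fun (z1 z2 s : R) : R := - (sin (pi * (s - z1)) * sin (pi * (s - z2))).
Definition strip (z1 z2 : R) : torus R -> R := tfun (fun s _ => strip_fun z1 z2 s).

Lemma strip_fun1 z1 z2 s : strip_fun z1 z2 (s + 1) = strip_fun z1 z2 s.
Proof.
have E z : pi * (s + 1 - z) = pi * (s - z) + pi by ring.
by rewrite /strip_fun !E !sinDpi mulrNN.
Qed.

Lemma strip_pi z1 z2 s t : strip z1 z2 (torus_pi (pt s t)) = strip_fun z1 z2 s.
Proof.
have := tfun_x_lift (strip_fun1 z1 z2) => /(congr1 (fun f => f (pt s t))).
by rewrite pt0.
Qed.

Lemma strip_cont z1 z2 : continuous (strip z1 z2).
Proof.
apply/(@quotient_continuous _ {eq_quot (@lattice_equiv R)}%qT _ (strip z1 z2)).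
have : continuous (lift_fun (strip z1 z2)); last by [].
rewrite (tfun_x_lift (strip_fun1 z1 z2)) => x; apply: differentiable_continuous.
have D (z : R) : der (fun s : R => sin (pi * (s - z))) (fun s => cos (pi * (s - z)) * (pi * (1 - 0))).
  exact: (der_comp (@der_sin R) (derZ pi (derB (@der_id R) (der_cst z)))).
exact: differentiable_coordfun (derN (derM (D z1) (D z2))).
Qed.

(** The zeros of the strip function lie over z1 and z2, where the wave is
    below 1. *)
Lemma strip_neq0 z1 z2 q : u z1 ^+ 2 + v z1 ^+ 2 < 1 -> u z2 ^+ 2 + v z2 ^+ 2 < 1 ->
  1 <= phi q -> strip z1 z2 q != 0.
Proof.
move=> h1 h2; rewrite leNgt; apply: contra.
rewrite /strip /tfun /strip_fun oppr_eq0 mulf_eq0 => /orP[/eqP h|/eqP h].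
  exact: (wave_lt1 u1 v1 h1 (sin_pi_eq0 h)).
exact: (wave_lt1 u1 v1 h2 (sin_pi_eq0 h)).
Qed.

Lemma wave_pt s t : phi (torus_pi (pt s t)) = u s * cs t - v s * sn t.
Proof. by rewrite (wave_val u1 v1) pt0 pt1. Qed.

(** At a zero of the derivative in y, the product of the wave with its
    derivative in x is S = u u' + v v'. So critical points lie over zeros of
    S, and both the zero s of S and the zero t of the derivative in y are
    simple, hence isolated. The covering map is open, which carries the
    neighbourhood down to the torus. *)
Lemma wave_isolated s t :
  u s * u' s + v s * v' s = 0 ->
  u' s ^+ 2 + v' s ^+ 2 + u s * u2 s + v s * v2 s != 0 ->
  1 < u s * cs t - v s * sn t -> u s * sn t + v s * cs t = 0 ->
  isolated_critical_point phi (torus_pi (pt s t)).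
Proof.
move=> Ss S's val1 ph0.
have [du du'] := Su; have [dv dv'] := Sv.
have k0 : two_pi != 0 :> R by rewrite mulrn_eq0/= lt0r_neq0// pi_gt0.
have u'1 := der_periodic du u1; have v'1 := der_periodic dv v1.
pose fx (a b : R) := u' a * cs b - v' a * sn b.
pose fy (a b : R) := u a * sn b + v a * cs b.
have crit p : critical_point phi p <->
    fx (torus_repr p 0 0) (torus_repr p 0 1) = 0 /\ fy (torus_repr p 0 0) (torus_repr p 0 1) = 0.
  have := critical_tensor2 p (wave_lift u1 v1) du (@der_cs R) (derN dv) (@der_sn R).
  set x := torus_repr p => ->; rewrite /tensor2 /tensor /fx /fy.
  set a := x 0 0; set b := x 0 1.
  have -> : u a * (- two_pi * sn b) + - v a * (two_pi * cs b) = - two_pi * (u a * sn b + v a * cs b) by ring.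
  have -> : u' a * cs b + - v' a * sn b = u' a * cs b - v' a * sn b by ring.
  split=> [[-> h]|[-> ->]]; last by rewrite mulr0.
  by split => //; move/eqP: h; rewrite mulf_eq0 oppr_eq0 (negbTE k0)/= => /eqP.
have crit_pi z : critical_point phi (torus_pi z) <-> fx (z 0 0) (z 0 1) = 0 /\ fy (z 0 0) (z 0 1) = 0.
  rewrite crit.
  have Ex : tfun fx (torus_pi z) = fx (z 0 0) (z 0 1).
    have := @lift_tfun R fx _ _ => /(_ _ _) /(congr1 (fun f => f z)) <- //.
      by move=> a b; rewrite /fx u'1 v'1.
    by move=> a b; rewrite /fx cs1 sn1.
  have Ey : tfun fy (torus_pi z) = fy (z 0 0) (z 0 1).
    have := @lift_tfun R fy _ _ => /(_ _ _) /(congr1 (fun f => f z)) <- //.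
      by move=> a b; rewrite /fy u1 v1.
    by move=> a b; rewrite /fy cs1 sn1.
  by rewrite -Ex -Ey.
(* at a zero of fy, phi * fx = S *)
have prod_id a b : fy a b = 0 ->
    (u a * cs b - v a * sn b) * fx a b = u a * u' a + v a * v' a.
  rewrite /fy /fx => h.
  have c2 : cs b ^+ 2 + sn b ^+ 2 = 1 by rewrite /cs /sn cos2Dsin2.
  have h2 : v a * cs b = - (u a * sn b) by lra.
  transitivity ((u a * u' a + v a * v' a) * (cs b ^+ 2 + sn b ^+ 2) -
      (u a * sn b + v a * cs b) * (v' a * cs b + u' a * sn b)); first by ring.
  by rewrite c2 h mul0r subr0 mulr1.
have dS : der (fun a => u a * u' a + v a * v' a)
   (fun a => u' a ^+ 2 + v' a ^+ 2 + u a * u2 a + v a * v2 a).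
  apply: (der_eq (derD (derM du du') (derM dv dv'))) => a; rewrite /u2 /v2; ring.
have [e1 e10 iso1] := isolated_zero dS Ss S's.
have dfy : der (fy s) (fun b => two_pi * (u s * cs b - v s * sn b)).
  by apply: (der_eq (derD (derZ (u s) (@der_sn R)) (derZ (v s) (@der_cs R)))) => b; ring.
have nz : two_pi * (u s * cs t - v s * sn t) != 0.
  by rewrite mulf_neq0// lt0r_neq0// (lt_trans ltr01).
have [e2 e20 iso2] := isolated_zero dfy ph0 nz.
split.
  apply/crit_pi; rewrite pt0 pt1; split => //.
  have := prod_id s t ph0; rewrite Ss => /eqP; rewrite mulf_eq0 => /orP[/eqP h|/eqP//].
  by move: val1; rewrite h ltr10.
pose B : set plane := [set z | `|z 0 0 - s| < e1 /\ `|z 0 1 - t| < e2].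
exists (@torus_pi R @` B); last first.
  move=> _ [z [z0 z1] <-] /crit_pi[h1 h2].
  have S0 : u (z 0 0) * u' (z 0 0) + v (z 0 0) * v' (z 0 0) = 0.
    by rewrite -(prod_id _ _ h2) h1 mulr0.
  have zs := iso1 _ z0 S0; rewrite zs in h2; have zt := iso2 _ z1 h2.
  congr torus_pi; apply/rowP => j; have [->|->] := I2_cases j; by rewrite ?pt0 ?pt1 ?zs ?zt.
apply: open_nbhs_nbhs; split; last first.
  by exists (pt s t) => //; rewrite /B /= pt0 pt1 !subrr normr0.
have : open (@torus_pi R @^-1` (@torus_pi R @` B)); last by [].
have -> : @torus_pi R @^-1` (@torus_pi R @` B) =
   \bigcup_(m in [set m : plane | m \is a mxOver Num.int])
     [set z : plane | `|z 0 0 - (s + m 0 0)| < e1 /\ `|z 0 1 - (t + m 0 1)| < e2].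
  apply/seteqP; split => z /=.
    move=> [w [w0 w1] E]; exists (z - w).
      by apply/(@eqmodP _ (@lattice_equiv R) z w).
    rewrite /= !mxE; split.
      by have -> : z 0 0 - (s + (z 0 0 - w 0 0)) = w 0 0 - s by ring.
    by have -> : z 0 1 - (t + (z 0 1 - w 0 1)) = w 0 1 - t by ring.
  move=> [m /= mI [z0 z1]]; exists (z - m).
    rewrite /B /= !mxE; split.
      by have -> : z 0 0 - m 0 0 - s = z 0 0 - (s + m 0 0) by ring.
    by have -> : z 0 1 - m 0 1 - t = z 0 1 - (t + m 0 1) by ring.
  apply: pi_eq; rewrite addrAC subrr sub0r; apply/mxOverP => i j.
  by rewrite mxE rpredN; exact: (mxOverP mI).
apply: bigcup_open => m _.
have op (j : 'I_2) (a e : R) : open [set z : plane | `|z 0 j - a| < e].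
  have -> : [set z : plane | `|z 0 j - a| < e] = (fun z : plane => z 0 j) @^-1` ball a e.
    by apply/seteqP; split => z; rewrite /ball /= distrC.
  apply: open_comp; last exact: ball_open.
  by move=> z _; exact: coord_continuous.
exact: openI (op 0 _ _) (op 1 _ _).
Qed.

(** The component of a point with phi = 1, or with phi > 1 in the complement
    of phi = 1, stays in the set phi >= 1, which the circles over z1 and z2 do
    not meet. *)
Lemma wave_geometry :
  [/\ infinite_set [set p | isolated_critical_point phi p],
      infinite_set (components [set p | phi p = 1]) &
      infinite_set (nodal_domains (fun p => phi p - 1))].
Proof.
have [z1 [x [z2 [H1 H2 H3]]]] := nested_bumps bump.
have [y Hy] := choice (fun n => let: And5 _ _ h _ _ := H3 n in (wave_phase h).1).
have [y' Hy'] := choice (fun n => let: And5 _ _ h _ _ := H3 n in (wave_phase h).2).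
have pos n t : 0 < strip (z1 n) (z2 n) (torus_pi (pt (x n) t)).
  rewrite strip_pi /strip_fun; have [h1 h2 h3 h4] := H1 n.
  rewrite oppr_gt0 pmulr_rlt0; first by apply: sin_pi_lt0; lra.
  by apply: sin_pi_gt0; lra.
have neg m n t : m <> n -> strip (z1 n) (z2 n) (torus_pi (pt (x m) t)) < 0.
  move=> /eqP; rewrite strip_pi /strip_fun oppr_lt0.
  have [h1 h2 h3 h4] := H1 n; have [k1 k2 k3 k4] := H1 m.
  rewrite neq_ltn => /orP[mn|nm].
    by have h := H2 _ _ mn; rewrite mulr_gt0//; apply: sin_pi_gt0; lra.
  by have h := H2 _ _ nm; rewrite nmulr_rgt0; apply: sin_pi_lt0; lra.
have nz n q : 1 <= phi q -> strip (z1 n) (z2 n) q != 0.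
  by have [h1 h2 _ _ _] := H3 n; exact: strip_neq0.
split.
- apply: (@infinite_of_inj _ _ (fun n => torus_pi (pt (x n) (y n)))).
    move=> n; have [_ _ h S0 S1] := H3 n; have [hy1 hy2] := Hy n.
    exact: wave_isolated.
  move=> m n E; apply: contrapT => mn.
  by have := neg m n (y m) mn; rewrite E ltNge ltW// pos.
- apply: (@infinite_components _ _ _ (fun n => torus_pi (pt (x n) (y' n)))
    (fun n => strip (z1 n) (z2 n))).
  + by move=> n; rewrite /= wave_pt Hy'.
  + by move=> n; exact: strip_cont.
  + move=> n q /connected_component_sub /= h; apply: nz; by rewrite h.
  + by move=> n; exact: pos.
  + by move=> m n; exact: neg.
- apply: (@infinite_components _ _ _ (fun n => torus_pi (pt (x n) (y n)))
    (fun n => strip (z1 n) (z2 n))).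
  + by move=> n; have [h _] := Hy n; rewrite /= wave_pt lt0r_neq0// subr_gt0.
  + by move=> n; exact: strip_cont.
  + move=> n q; set A := [set p | _]; set P := torus_pi _ => Cq; apply: nz.
    have [h _] := Hy n.
    have hP : 0 < phi P - 1 by rewrite /P wave_pt subr_gt0.
    have AP : A P by rewrite /A /= lt0r_neq0.
    have cf : continuous (fun p => phi p - 1).
      have cw : continuous phi by exact: wave_cont Su Sv u1 v1.
      have cm : continuous (fun r : R => r - 1) := der_cont (derB (@der_id R) (der_cst 1)).
      by move=> p; exact: (continuous_comp (cw p) (cm (phi p))).
    have := connected_sign (component_connected (A := A) (x := P)) cf _ (connected_component_refl AP) Cq hP.
    move=> K; have : 0 < phi q - 1 by apply: K => r /connected_component_sub.
    by rewrite subr_gt0 => /ltW.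
  + by move=> n; exact: pos.
  + by move=> m n; exact: neg.
Qed.

End WaveGeometry.

(** * Conclusion *)

Unset Implicit Arguments.

Theorem mainTheorem2 (R : realType) :
  (exists (g : riemannian_metric R) (phi : nat -> torus R -> R)
     (lambda : nat -> R),
     [/\ forall i, eigenfunction g (lambda i) (phi i),
         lambda i @[i --> \oo] --> +oo &
         forall i,
           infinite_set [set p | isolated_critical_point (phi i) p] /\
           exists L : R, infinite_set (components [set p | phi i p = L])])
  /\
  (exists (g : riemannian_metric R) (mu nu : R) (u v : torus R -> R) (a b : R),
     [/\ eigenfunction g mu u, eigenfunction g nu v &
         infinite_set (nodal_domains (fun p => a * u p + b * v p))]).
Proof.
have [Q [Qs Qp Q1 HL]] := @modes R.
pose g := conformal_metric Qs Qp Q1.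
have key L : exists p : R * (torus R -> R), [/\ L < p.1, eigenfunction g p.1 p.2,
  infinite_set [set q | isolated_critical_point p.2 q],
  infinite_set (components [set q | p.2 q = 1]) &
  infinite_set (nodal_domains (fun q => p.2 q - 1))].
  have [l [u [v [Ll l0 [u' [v' [[su sv] [Su Sv] [u1 v1] bump]]]]]]] := HL L.
  have [h1 h2 h3] := wave_geometry Su Sv u1 v1 bump.
  exists (l, wave u v); split; [exact: Ll| |exact: h1|exact: h2|exact: h3].
  exact: (wave_eigen Qs Qp Q1 l0 su sv Su Sv u1 v1 bump).
have [f Hf] := choice (fun i : nat => key i%:R).
split.
  exists g, (fun i => (f i).2), (fun i => (f i).1); split.
  - by move=> i; have [] := Hf i.
  - apply/cvgryPge => A; near=> i.
    have [h _ _ _ _] := Hf i; apply: le_trans (ltW h).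
    by near: i; exact: nbhs_infty_ger.
  - by move=> i; have [_ _ h1 h2 _] := Hf i; split => //; exists 1.
have [_ h1 _ _ h2] := Hf 0%N.
exists g, (f 0%N).1, 0, (f 0%N).2, (cst 1), 1, (-1); split => //.
  exact: const_eigen.
by have -> : (fun p => 1 * (f 0%N).2 p + -1 * cst 1 p) = (fun p => (f 0%N).2 p - 1)
  by apply/funext => p; rewrite /cst mul1r mulr1.
Unshelve. all: by end_near. Qed.
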